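(* Let $n$ be a positive integer, $N=n^2$, and let $\theta^* \in \mathbb{R}^{n\times n}$ be given by $\theta^*_{ij} = 1$ if $j > n/2$ and $\theta^*_{ij}=0$ otherwise. For $\sigma>0$ observe $y = \theta^* + \sigma Z$ with $Z$ having i.i.d. standard normal entries, and let $\mathbf{V}^* = \mathrm{TV}_{\mathrm{norm}}(\theta^* )$. Then there is a universal constant $c>0$ such that $$\lim_{\sigma \to 0}\frac{1}{\sigma^2}\mathrm{MSE}(\hat\theta_{\mathbf{V}^*},\theta^* ) \geq \frac{c}{N^{3/4}}.$$
   Context: $\mathrm{TV}_{\mathrm{norm}}(\theta) = \frac{1}{n}\sum_{(u,v)\in E_n}|\theta_u - \theta_v|$, where $E_n$ is the edge set of the $n\times n$ grid graph on $[n]\times[n]$. The constrained TVD estimator is $\hat\theta_{\mathbf{V}} = \operatorname{argmin}_{\theta: \mathrm{TV}_{\mathrm{norm}}(\theta)\le \mathbf{V}} \|y - \theta\|^2$ (Frobenius norm), and $\mathrm{MSE}(\hat\theta,\theta^* ) = \mathbb{E}\|\hat\theta - \theta^*\|^2/N$. *)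

(* Defs.v *)
From HB Require Import structures.
From mathcomp Require Import all_boot all_order all_algebra.
From mathcomp Require Import all_classical all_reals all_analysis.
Set Implicit Arguments. Unset Strict Implicit. Unset Printing Implicit Defensive.
Import Order.TTheory GRing.Theory Num.Theory.
Import numFieldNormedType.Exports.
Local Open Scope classical_set_scope.
Local Open Scope ring_scope.

Section TVD.
Variable R : realType.

Definition grid (n : nat) := 'I_n -> 'I_n -> R.

(* Directed edge relation of the n x n grid graph: (u,v) is an edge when v is
   the right neighbour or the lower neighbour of u.  Each undirected edge of
   E_n is thus counted exactly once. *)
Definition grid_edge (n : nat) (u v : 'I_n * 'I_n) : bool :=
  ((u.1 == v.1 :> nat) && (v.2 == (u.2).+1 :> nat)) ||
  ((u.2 == v.2 :> nat) && (v.1 == (u.1).+1 :> nat)).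

Definition TV_norm (n : nat) (th : grid n) : R :=
  n%:R^-1 * \sum_(u : 'I_n * 'I_n) \sum_(v : 'I_n * 'I_n | grid_edge u v)
     `|th u.1 u.2 - th v.1 v.2|.

Definition frob2 (n : nat) (a b : grid n) : R :=
  \sum_(i < n) \sum_(j < n) (a i j - b i j) ^+ 2.

Definition is_TVD_min (n : nat) (V : R) (y th : grid n) : Prop :=
  TV_norm th <= V /\ forall t : grid n, TV_norm t <= V -> frob2 y th <= frob2 y t.

(* The constrained TVD estimator (the minimiser is unique, the constraint set
   being nonempty, closed and convex and the objective strictly convex). *)
Definition tvd_est (n : nat) (V : R) (y : grid n) : grid n :=
  get [set th | is_TVD_min V y th].

(* theta*_{ij} = 1 if j > n/2 (1-based column index j), 0 otherwise. *)
Definition theta_star (n : nat) : grid n :=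
  fun i j => if (n < 2 * (j : nat).+1)%N then 1 else 0.

(* Gaussian expectation of f(z_0, ..., z_{k-1}) for i.i.d. standard normal
   z_0..z_{k-1}, as an iterated integral (coordinates >= k are set to 0). *)
Definition upd (z : nat -> R) (k : nat) (x : R) : nat -> R :=
  fun i => if i == k then x else z i.

Fixpoint gauss_expect (k : nat) (f : (nat -> R) -> \bar R) : \bar R :=
  match k with
  | 0 => f (fun _ => 0)
  | k'.+1 => (\int[normal_prob (0:R) 1]_x gauss_expect k' (fun z => f (upd z k' x)))%E
  end.

Definition noise (n : nat) (z : nat -> R) : grid n :=
  fun i j => z (i * n + j)%N.

Definition MSE_tvd (n : nat) (V sigma : R) (th : grid n) : \bar R :=
  (gauss_expect (n ^ 2)
     (fun z => (frob2 (tvd_est V (fun i j => th i j + sigma * noise z i j)) th)%:E)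
   * ((n ^ 2)%:R^-1)%:E)%E.

End TVD.
Arguments theta_star R n _ _ : clear implicits.

(* Main.v *)
Require Import Defs.
From HB Require Import structures.
From mathcomp Require Import all_boot all_order all_algebra.
From mathcomp Require Import all_classical all_reals all_analysis.
From mathcomp Require Import measurable_realfun ring lra zify.
Import Order.TTheory GRing.Theory Num.Theory.
Import numFieldNormedType.Exports.
Local Open Scope classical_set_scope.
Local Open Scope ring_scope.

(* For a fixed noise z and sigma small, the polyhedral set {TV <= V*} coincides
   near theta* with theta* + T, T its tangent cone, so that the estimator is
   exactly theta* + sigma P_T(z).  Since projections are nonexpansive, dominated
   convergence gives the limit E|P_T(Z)|^2 / N.  For every v in T,
   |P_T z|^2 >= 2 <v, z> - |v|^2.  Take v equal to a constant c on the left half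
   plus, on its last column, h (1 + sgn S_B) on each block B of l ~ sqrt n rows,
   where S_B is the noise summed over the block and c = 2 h / l makes v tangent.
   As E|S_B| is of order sqrt l, choosing h of order n^(-1/4) gives
   E|P_T(Z)|^2 >= const * sqrt n.  The bound |x| >= t x^2 - t^3 x^4 reduces
   E|S_B| to second and fourth moments. *)

(** Why these scales: at most n / l block boundaries cost 2 h each, and lowering the jump by c = 2 h
    / l in each of the n rows repays them. Then |v|^2 is of order c^2 n^2 + h^2 n, whose two terms
    balance at l ~ sqrt n, while <v, Z> has mean of order h (n / l) sqrt l = h n^(3/4). Maximising h
    n^(3/4) - h^2 n over h gives n^(-1/4) and the value sqrt n; dividing by N = n^2 leaves N^(-3/4).

    The analytic obstacle is that the expectation is an iterated integral and the estimator is known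
    only as a minimiser, so every partial integral has to be shown measurable and finite. The class
    [tame] serves this purpose. Its sequential continuity holds for projections because they are
    nonexpansive. Its bound by a product of factors 1 + z_i^4 survives fixing a coordinate, and its
    degree is the one that fourth moments require. *)

(** * Integrals against the standard normal law *)

Section NormalMoments.
Context {R : realType}.
Local Notation mu := (@lebesgue_measure R).
Local Notation nu := (normal_prob (0 : R) 1).

(** The Radon-Nikodym derivative of the law and [normal_pdf] have equal integrals over all
    measurable sets, hence agree almost everywhere. *)
Lemma ge0_integral_normal_prob (m s : R) (f : R -> \bar R) :
  measurable_fun setT f -> (forall x, 0 <= f x)%E ->
  (\int[normal_prob m s]_x f x = \int[mu]_x (f x * (normal_pdf m s x)%:E))%E.
Proof.
move=> mf f0.
have dom := @normal_prob_dominates R m s.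
rewrite -(Radon_Nikodym_SigmaFinite.change_of_variables dom)//.
apply: ae_eq_integral => //.
- apply: emeasurable_funM => //.
  exact: measurable_int (Radon_Nikodym_SigmaFinite.f_integrable _).
- apply: emeasurable_funM => //.
  by apply/measurable_EFinP; exact: measurable_normal_pdf.
- apply: ae_eqe_mul2l; apply: integral_ae_eq => //.
  + exact: Radon_Nikodym_SigmaFinite.f_integrable.
  + by apply/measurable_EFinP; exact: measurable_normal_pdf.
  + by move=> E _ mE; rewrite -Radon_Nikodym_SigmaFinite.f_integral.
Qed.

Lemma ge0_integral_oppT (G : R -> R) : continuous G -> (forall x, 0 <= G x) ->
  (\int[mu]_x (G x)%:E = \int[mu]_x (G (- x))%:E)%E.
Proof.
move=> cG G0.
(* Reflection exchanges the two half-lines. The endpoint is written [- 0] to match the image of 0 in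
   the substitution rule. *)
have split0 (H : R -> R) : continuous H -> (forall x, 0 <= H x) ->
    (\int[mu]_x (H x)%:E = \int[mu]_(x in `]-oo, (- 0)%R]) (H x)%:E
       + \int[mu]_(x in `[0%R, +oo[) (H x)%:E)%E.
  move=> cH H0; have mH : measurable_fun setT H by exact: continuous_measurable_fun.
  rewrite oppr0 -[in LHS](setUv `]-oo, (0:R)%R[) setCitvl ge0_integral_setU//=.
  - rewrite integral_itv_bndo_bndc//.
    by apply/measurable_EFinP/measurable_funTS.
  - by apply/measurable_EFinP; apply: measurable_funTS.
  - by move=> x _; rewrite lee_fin.
  - rewrite disj_set2E; apply/eqP; rewrite -subset0 => x/=.
    by rewrite !in_itv/= andbT ltNge => -[/negP].
have cGN : continuous (fun x => G (- x)).
  by move=> x; apply: (@continuous_comp _ _ _ -%R G); [exact: oppr_continuous|exact: cG].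
rewrite (split0 G)// (split0 (fun x => G (- x)))//.
rewrite addeC; congr (_ + _)%E.
  rewrite ge0_integration_by_substitutionNy//=; last exact: continuous_subspaceT.
  by apply: eq_integral => x _; rewrite /= opprK.
by rewrite ge0_integration_by_substitutionNy//=; exact: continuous_subspaceT.
Qed.

Lemma normal_pdfN (x : R) : normal_pdf 0 1 (- x) = normal_pdf 0 1 x.
Proof. by rewrite normal_pdfE// /normal_fun !subr0 sqrrN. Qed.

Lemma integrable_normal_exp4 : nu.-integrable setT (fun x => (x ^+ 4)%:E).
Proof.
have m4 : measurable_fun setT (fun x : R => (x ^+ 4)%:E).
  by apply/measurable_EFinP; exact: measurable_funX.
have p4 (x : R) : 0 <= x ^+ 4 by rewrite exprn_even_ge0.
apply/integrableP; split => //.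
under eq_integral do rewrite gee0_abs ?lee_fin//.
rewrite ge0_integral_normal_prob//.
(* Comparison with the normal law of standard deviation 2: x^4 exp(- x^2 / 2) <= 16 exp(- x^2 / 8).
   With u = 3 x^2 / 8, the bound exp u >= 1 + u^2 / 2 gives 16 exp u >= 9 x^4 / 8. *)
pose C : R := 16 * normal_peak 1 / normal_peak 2.
have pk1 : 0 < normal_peak (1 : R) by rewrite normal_peak_gt0.
have pk2 : 0 < normal_peak (2 : R) by rewrite normal_peak_gt0.
apply: (@le_lt_trans _ _ (\int[mu]_x (C%:E * (normal_pdf 0 2 x)%:E))%E).
  apply: ge0_le_integral => //.
  - by move=> x _; rewrite -EFinM lee_fin mulr_ge0// normal_pdf_ge0.
  - apply: emeasurable_funM => //.
    by apply/measurable_EFinP; exact: measurable_normal_pdf.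
  - apply: emeasurable_funM => //.
    by apply/measurable_EFinP; exact: measurable_normal_pdf.
  move=> x _; rewrite -!EFinM lee_fin !normal_pdfE// -/C; cbv beta.
  have -> : C * (normal_peak 2 * normal_fun 0 2 x) =
      16 * normal_peak 1 * normal_fun 0 2 x.
    by rewrite /C; field; exact: lt0r_neq0.
  rewrite mulrCA [16 * _]mulrC -[leRHS]mulrA ler_pM2l//.
  rewrite /normal_fun !subr0.
  have -> : - x ^+ 2 / (1 ^+ 2 *+ 2) =
            - (3 / 8 * x ^+ 2) + - x ^+ 2 / (2 ^+ 2 *+ 2) :> R by field.
  rewrite expRD mulrA ler_pM2r ?expR_gt0// expRN ler_pdivrMr ?expR_gt0//.
  have x0 : 0 <= 3 / 8 * x ^+ 2 by rewrite mulr_ge0 ?sqr_ge0//; lra.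
  have := expR_ge1Dxn 1 x0; rewrite (_ : 2`!%:R = 2)// => h.
  have := p4 x; have -> : x ^+ 4 = (x ^+ 2) ^+ 2 by rewrite -exprM.
  by move: h; rewrite exprMn; lra.
rewrite integralZl//; last exact: integrable_normal_pdf.
by rewrite integral_normal_pdf mule1 ltry.
Qed.

Lemma integrable_normal_bound (g : R -> R) (C : R) : continuous g ->
  (forall x, `|g x| <= C * (1 + x ^+ 4)) -> nu.-integrable setT (EFin \o g).
Proof.
move=> cg gC.
have i4 : nu.-integrable setT (fun x => (C * (1 + x ^+ 4))%:E).
  have i1 : nu.-integrable setT (EFin \o cst (1 : R)).
    exact: finite_measure_integrable_cst.
  have := integrableZl measurableT C (integrableD measurableT i1 integrable_normal_exp4).
  by apply: eq_integrable => // x _; rewrite /= -EFinD -EFinM.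
apply: (le_integrable _ _ _ i4) => //.
  by apply/measurable_EFinP; exact: continuous_measurable_fun.
by move=> x _; rewrite /= lee_fin (le_trans (gC x))// ler_norm.
Qed.

Lemma integral_normal_odd (g : R -> R) (C : R) : continuous g ->
  (forall x, `|g x| <= C * (1 + x ^+ 4)) -> (forall x, g (- x) = - g x) ->
  (\int[nu]_x (g x)%:E = 0)%E.
Proof.
move=> cg gC odd.
have ig : nu.-integrable setT (EFin \o g) by exact: integrable_normal_bound gC.
have cn : continuous (fun x => `|g x|).
  by move=> x; apply: cvg_norm; exact: cg.
have in_ : nu.-integrable setT (fun x => `|g x|%:E).
  by apply: (@integrable_normal_bound _ C) => // x; rewrite normr_id.
(* Reflection is available for nonnegative functions; [G] is one, and [G (- x)] is |g| - g. Equality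
   of the two integrals forces that of g to vanish. *)
pose G x := `|g x| + g x.
have cG : continuous G by move=> x; apply: cvgD; [exact: cn|exact: cg].
have G0 x : 0 <= G x by rewrite /G; have := ler_norm (- g x); rewrite normrN; lra.
have GN x : G (- x) = `|g x| - g x by rewrite /G odd normrN.
have cGN : continuous (fun x => G (- x)).
  by move=> x; apply: (@continuous_comp _ _ _ -%R G); [exact: oppr_continuous|exact: cG].
have E : (\int[nu]_x (G x)%:E = \int[nu]_x (G (- x))%:E)%E.
  rewrite !ge0_integral_normal_prob//.
  - under eq_integral do rewrite -EFinM.
    rewrite (@ge0_integral_oppT (fun x => G x * normal_pdf 0 1 x)).
    + by apply: eq_integral => x _; rewrite normal_pdfN EFinM.
    + move=> x; apply: cvgM; first exact: cG.
      exact: continuous_normal_pdf.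
    + by move=> x; rewrite mulr_ge0 ?normal_pdf_ge0.
  - by apply/measurable_EFinP; exact: continuous_measurable_fun.
  - by move=> x; rewrite lee_fin.
  - by apply/measurable_EFinP; exact: continuous_measurable_fun.
move: E; under eq_integral do rewrite EFinD.
under [in X in _ = X]eq_integral do rewrite GN EFinB.
rewrite integralD// integralB//.
have f1 := integrable_fin_num measurableT ig.
have f2 := integrable_fin_num measurableT in_.
rewrite -(fineK f1) -(fineK f2) -EFinB -EFinD => -[] /=.
by move=> h; congr EFin; lra.
Qed.

(** Otherwise x^2 = 0 almost surely and the whole mass sits at 0, which is a null set because the
    law has a density. *)
Lemma integral_normal_sqr_gt0 : (0 < \int[nu]_x (x ^+ 2)%:E)%E.
Proof.
have m2 : measurable_fun setT (fun x : R => (x ^+ 2)%:E).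
  by apply/measurable_EFinP; exact: measurable_funX.
rewrite lt0e integral_ge0//; last by move=> x _; rewrite lee_fin sqr_ge0.
rewrite andbT; apply/eqP => h.
have /ae_eq_integral_abs : (\int[nu]_x `|(x ^+ 2)%:E| = 0)%E.
  by rewrite -h; apply: eq_integral => x _; rewrite gee0_abs// lee_fin sqr_ge0.
move=> /(_ measurableT m2) [N [mN N0 sub]].
have N1 : nu (setT `\` [set 0]) = 0%E.
  apply: (subset_measure0 _ mN) N0 => //; first exact: measurableD.
  move=> x [_ /= x0]; apply: sub => /= /(_ I) [] xx0; apply: x0.
  by apply/eqP; rewrite -sqrf_eq0 xx0.
have := @probability_setT _ _ R nu.
rewrite -(setUv [set (0 : R)]) -setTD measureU//; last first.
- by rewrite setDE setTI setICr.
- exact: measurableD.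
rewrite [X in (_ + X)%E]N1 adde0 [LHS]/= /normal_prob integral_set1 => /eqP.
by rewrite eq_sym onee_eq0.
Qed.
End NormalMoments.

(** * Iterated Gaussian expectations of continuous functions of polynomial growth *)

Section GaussExpect.
Context {R : realType}.
Local Notation nu := (normal_prob (0 : R) 1).
Implicit Types (f g : (nat -> R) -> R) (z : nat -> R) (k : nat).

Definition seqcont f := forall (z_ : nat -> nat -> R) z,
  (forall i, z_ m i @[m --> \oo] --> z i) -> f (z_ m) @[m --> \oo] --> f z.

(** A product, so that fixing one coordinate at x releases a single factor 1 + x^4, integrable
    against the normal law. *)
Definition weight (K : nat) z : R := \prod_(i < K) (1 + z i ^+ 4).

Definition dominated (K : nat) (C : R) f := forall z, `|f z| <= C * weight K z.

Definition tame f := seqcont f /\ exists K C, dominated K C f.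

Definition gmean k f : R := fine (gauss_expect k (EFin \o f)).

Lemma factor_ge1 (x : R) : 1 <= 1 + x ^+ 4.
Proof. by rewrite lerDl exprn_even_ge0. Qed.

Lemma weight_ge1 K z : 1 <= weight K z.
Proof.
rewrite /weight; elim/big_ind: _ => // [x y x1 y1|i _]; last exact: factor_ge1.
by rewrite -[1]mulr1 ler_pM.
Qed.

Lemma weight_gt0 K z : 0 < weight K z.
Proof. exact: lt_le_trans ltr01 (weight_ge1 _ _). Qed.

Lemma dominated_ge0 K C f : dominated K C f -> 0 <= C.
Proof.
move=> /(_ (fun=> 0)) h; have := le_trans (normr_ge0 _) h.
by rewrite pmulr_lge0 ?weight_gt0.
Qed.

(** For k < K the update replaces one factor, and the old one is at least 1; for k >= K nothing
    changes and the extra factor is at least 1. *)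
Lemma weight_upd K z k x : weight K (upd z k x) <= (1 + x ^+ 4) * weight K z.
Proof.
elim: K => [|K IH]; first by rewrite /weight !big_ord0 mulr1 factor_ge1.
rewrite /weight !big_ord_recr /= -!/(weight _ _) {2}/upd.
have [<-|_] := eqVneq K k; last first.
  by rewrite mulrA ler_pM2r// (lt_le_trans _ (factor_ge1 _)).
have -> : weight K (upd z K x) = weight K z.
  by apply: eq_bigr => i _; rewrite /upd ltn_eqF.
rewrite mulrC ler_pM2l ?(lt_le_trans _ (factor_ge1 _))//.
by rewrite ler_peMr ?factor_ge1// ltW ?weight_gt0.
Qed.

Lemma seqcont_upd f k x : seqcont f -> seqcont (fun z => f (upd z k x)).
Proof.
move=> cf z_ z zz; apply: cf => i; rewrite /upd.
by case: (i == k); [exact: cvg_cst|exact: zz].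
Qed.

Lemma dominated_upd K C f k x : dominated K C f ->
  dominated K (C * (1 + x ^+ 4)) (fun z => f (upd z k x)).
Proof.
move=> df z; rewrite (le_trans (df _))// -mulrA ler_wpM2l ?weight_upd//.
exact: dominated_ge0 df.
Qed.

Lemma tame_upd f k x : tame f -> tame (fun z => f (upd z k x)).
Proof.
move=> [cf [K [C df]]]; split; first exact: seqcont_upd.
by exists K, (C * (1 + x ^+ 4)); exact: dominated_upd.
Qed.

Lemma seq_continuous (g : R -> R) :
  (forall (u : nat -> R) x, u m @[m --> \oo] --> x ->
     g (u m) @[m --> \oo] --> g x) -> continuous g.
Proof.
move=> h x; apply/continuous_withinNx/cvgr_dnbhsP => u [_ ux]; exact: h.
Qed.

Let A : R := fine (\int[nu]_x (1 + x ^+ 4)%:E).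

Lemma integrable_factor : nu.-integrable setT (fun x => (1 + x ^+ 4)%:E).
Proof.
apply: (@integrable_normal_bound _ (fun x => 1 + x ^+ 4) 1).
  move=> x; apply: cvgD; first exact: cvg_cst.
  exact: exprn_continuous.
by move=> x; rewrite mul1r ger0_norm// (le_trans _ (factor_ge1 _)).
Qed.

(* The induction hypothesis: besides finiteness, dominated convergence at level
   [k] is what makes the level [k.+1] integrand continuous, hence measurable. *)
Let good k :=
  (forall K C f, seqcont f -> dominated K C f ->
     gauss_expect k (EFin \o f) = (gmean k f)%:E /\ `|gmean k f| <= C * A ^+ k) /\
  (forall K C (f_ : nat -> (nat -> R) -> R) f,
     (forall m, seqcont (f_ m)) -> (forall m, dominated K C (f_ m)) ->
     seqcont f -> dominated K C f ->
     (forall z, f_ m z @[m --> \oo] --> f z) ->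
     gmean k (f_ m) @[m --> \oo] --> gmean k f).

(** A convergent sequence is bounded, say by M, so all the functions obtained by fixing coordinate k
    along it share the domination constant C (1 + M^4), and dominated convergence at level k
    applies. *)
Let good_continuous k K C f : good k -> seqcont f -> dominated K C f ->
  continuous (fun x => gmean k (fun z => f (upd z k x))).
Proof.
move=> [_ IH2] cf df; apply: seq_continuous => u x ux.
have /cvg_seq_bounded[M1 [_ Mb]] : cvgn u by apply/cvg_ex; exists x.
have [M Mu] : exists M, forall m, `|u m| <= M.
  by exists (M1 + 1) => m; apply: Mb; rewrite // ltrDl.
have M0 : 0 <= M by rewrite (le_trans (normr_ge0 (u 0%N))).
have xM : `|x| <= M.
  by apply: (cvgr_to_le (cvg_norm ux)); exact: nearW.
have C0 := dominated_ge0 _ _ _ df.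
have dM y : `|y| <= M -> dominated K (C * (1 + M ^+ 4)) (fun z => f (upd z k y)).
  move=> yM z; rewrite (le_trans (dominated_upd _ _ _ k y df z))//.
  rewrite ler_pM2r ?weight_gt0// ler_wpM2l// lerD2l -[y ^+ 4]ger0_norm ?exprn_even_ge0//.
  by rewrite normrX lerXn2r ?nnegrE.
apply: (IH2 K (C * (1 + M ^+ 4))).
- by move=> m; exact: seqcont_upd.
- by move=> m; exact: dM.
- exact: seqcont_upd.
- exact: dM.
- move=> z; apply: cf => i; rewrite /upd.
  by case: (i == k); [exact: ux|exact: cvg_cst].
Qed.

Let good_bound k K C f : good k -> seqcont f -> dominated K C f ->
  forall x, `|gmean k (fun z => f (upd z k x))| <= C * A ^+ k * (1 + x ^+ 4).
Proof.
move=> [IH1 _] cf df x; rewrite mulrAC.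
exact: (IH1 _ _ _ (seqcont_upd _ k x cf) (dominated_upd _ _ _ k x df)).2.
Qed.

Let good_integrable k K C f : good k -> seqcont f -> dominated K C f ->
  nu.-integrable setT (fun x => (gmean k (fun z => f (upd z k x)))%:E).
Proof.
move=> gk cf df; apply: (integrable_normal_bound _ (C * A ^+ k)).
  exact: good_continuous df.
exact: good_bound.
Qed.

(** At level k + 1 the outer integrand is at most [C * A ^+ k * (1 + x ^+ 4)]. This integrates to
    [C * A ^+ k.+1], and it dominates a whole sequence at once. *)
Let gmean_good k : good k.
Proof.
elim: k => [|k gk].
  split; last by move=> K C f_ f _ _ _ _ ff; exact: ff.
  move=> K C f cf df; split=> //; have := df (fun=> 0).
  by rewrite /weight big1// => i _; rewrite expr0n addr0.
have intg K C f := good_integrable k K C f gk.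
have bound K C f := good_bound k K C f gk.
move: gk => [IH1 IH2].
have expS K C f : seqcont f -> dominated K C f ->
    (gauss_expect k.+1 (EFin \o f) =
     \int[nu]_x (gmean k (fun z => f (upd z k x)))%:E)%E.
  move=> cf df; apply: eq_integral => x _.
  exact: (IH1 _ _ _ (seqcont_upd _ k x cf) (dominated_upd _ _ _ k x df)).1.
split.
  move=> K C f cf df; have fin : gauss_expect k.+1 (EFin \o f) \is a fin_num.
    by rewrite (expS K C)//; apply: integrable_fin_num => //; exact: intg df.
  rewrite /gmean fineK//; split=> //.
  rewrite (expS K C)//; have intf := intg _ _ _ cf df.
  rewrite -lee_fin -fine_abse; last by apply: integrable_fin_num.
  rewrite fineK; last first.
    by rewrite abse_fin_num; apply: integrable_fin_num.
  apply: (le_trans (le_abse_integral nu measurableT _)).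
    exact: measurable_int intf.
  apply: (@le_trans _ _ (\int[nu]_x ((C * A ^+ k)%:E * (1 + x ^+ 4)%:E))%E).
    apply: le_integral => //.
    - exact: integrable_abse.
    - by apply: integrableZl => //; exact: integrable_factor.
    - by move=> x _; rewrite /= -EFinM lee_fin (bound K C f).
  rewrite integralZl//; last exact: integrable_factor.
  rewrite -(fineK (integrable_fin_num measurableT integrable_factor)) -EFinM lee_fin.
  by rewrite -/A exprSr mulrA.
move=> K C f_ f cf_ df_ cf df ff.
have [_ _] : [/\ nu.-integrable setT (fun x => (gmean k (fun z => f (upd z k x)))%:E),
  [sequence \int[nu]_x `|(gmean k (fun z => f_ m (upd z k x)))%:E -
     (gmean k (fun z => f (upd z k x)))%:E|]_m @ \oo --> 0 &
  [sequence \int[nu]_x (gmean k (fun z => f_ m (upd z k x)))%:E]_m @ \oo -->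
  \int[nu]_x (gmean k (fun z => f (upd z k x)))%:E ]%E.
  apply: (@dominated_convergence _ _ _ nu setT measurableT
     (fun m x => (gmean k (fun z => f_ m (upd z k x)))%:E)
     (fun x => (gmean k (fun z => f (upd z k x)))%:E)
     (fun x => (C * A ^+ k)%:E * (1 + x ^+ 4)%:E)%E).
  - by move=> m; exact: measurable_int (intg _ _ _ (cf_ m) (df_ m)).
  - exact: measurable_int (intg _ _ _ cf df).
  - apply: aeW => x _; apply: cvg_EFin; first exact: nearW.
    apply: (IH2 K (C * (1 + x ^+ 4))).
    + by move=> m; exact: seqcont_upd.
    + by move=> m; exact: dominated_upd.
    + exact: seqcont_upd.
    + exact: dominated_upd.
    + by move=> z; exact: ff.
  - by apply: integrableZl => //; exact: integrable_factor.
  - by apply: aeW => x m _; rewrite -EFinM lee_fin (bound K C).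
move=> cv.
have fm : gmean k.+1 \o f_ = fine \o (fun m =>
    \int[nu]_x (gmean k (fun z => f_ m (upd z k x)))%:E)%E.
  by apply/funext => m /=; rewrite {1}/gmean (expS K C).
have -> : gmean k.+1 f =
    fine (\int[nu]_x (gmean k (fun z => f (upd z k x)))%:E)%E.
  by rewrite {1}/gmean (expS K C).
rewrite -[X in X @ _]/(gmean k.+1 \o f_) fm.
apply: fine_cvg; rewrite fineK//.
by apply: integrable_fin_num => //; exact: intg df.
Qed.

Lemma gauss_expect_tame k f : tame f ->
  gauss_expect k (EFin \o f) = (gmean k f)%:E.
Proof. by move=> [cf [K [C df]]]; have [] := (gmean_good k).1 K C f cf df. Qed.

Lemma gmean_cvg k K C (f_ : nat -> (nat -> R) -> R) f :
  (forall m, seqcont (f_ m)) -> (forall m, dominated K C (f_ m)) ->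
  seqcont f -> dominated K C f ->
  (forall z, f_ m z @[m --> \oo] --> f z) ->
  gmean k (f_ m) @[m --> \oo] --> gmean k f.
Proof. exact: (gmean_good k).2. Qed.

Lemma gmeanS k f : tame f ->
  gmean k.+1 f = (\int[nu]_x gmean k (fun z => f (upd z k x)))%R.
Proof.
move=> tf; rewrite /Rintegral {1}/gmean; congr fine; apply: eq_integral => x _.
exact: gauss_expect_tame (tame_upd _ k x tf).
Qed.

Lemma gmean_integrable k f : tame f ->
  nu.-integrable setT (EFin \o (fun x => gmean k (fun z => f (upd z k x)))).
Proof. by move=> [cf [K [C df]]]; exact: good_integrable (gmean_good k) cf df. Qed.

Lemma tame_cst (c : R) : tame (fun=> c).
Proof.
split; first by move=> *; exact: cvg_cst.
by exists 0%N, `|c| => z; rewrite /weight big_ord0 mulr1.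
Qed.

Lemma weight_le K K' z : (K <= K')%N -> weight K z <= weight K' z.
Proof.
move=> /subnKC <-; elim: (K' - K)%N => [|d IH]; first by rewrite addn0.
rewrite addnS {2}/weight big_ord_recr /= -/(weight _ _).
by rewrite (le_trans IH)// ler_peMr ?factor_ge1// ltW ?weight_gt0.
Qed.

Lemma tameD f g : tame f -> tame g -> tame (fun z => f z + g z).
Proof.
move=> [cf [K [C df]]] [cg [K' [C' dg]]]; split.
  by move=> z_ z zz; apply: cvgD; [exact: cf|exact: cg].
exists (maxn K K'), (C + C') => z; rewrite (le_trans (ler_normD _ _))// mulrDl.
rewrite lerD//.
- rewrite (le_trans (df z))// ler_wpM2l ?(dominated_ge0 _ _ _ df)//.
  by rewrite weight_le ?leq_maxl.
- rewrite (le_trans (dg z))// ler_wpM2l ?(dominated_ge0 _ _ _ dg)//.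
  by rewrite weight_le ?leq_maxr.
Qed.

Lemma tameZ (c : R) f : tame f -> tame (fun z => c * f z).
Proof.
move=> [cf [K [C df]]]; split.
  by move=> z_ z zz; apply: cvgM; [exact: cvg_cst|exact: cf].
by exists K, (`|c| * C) => z; rewrite normrM -mulrA ler_wpM2l.
Qed.

Lemma tame_sum (I : Type) (r : seq I) (P : pred I) (F : I -> (nat -> R) -> R) :
  (forall i, P i -> tame (F i)) -> tame (fun z => \sum_(i <- r | P i) F i z).
Proof.
move=> tF; elim: r => [|i r IH].
  rewrite [X in tame X](_ : _ = fun=> 0); first exact: tame_cst.
  by apply/funext => z; rewrite big_nil.
have [Pi|nPi] := boolP (P i).
  rewrite [X in tame X](_ : _ = fun z => F i z + \sum_(i <- r | P i) F i z).
    by apply: tameD => //; exact: tF.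
  by apply/funext => z; rewrite big_cons Pi.
rewrite [X in tame X](_ : _ = fun z => \sum_(i <- r | P i) F i z)//.
by apply/funext => z; rewrite big_cons (negbTE nPi).
Qed.

Lemma gmean_cst k (c : R) : gmean k (fun=> c) = c.
Proof.
elim: k => // k IH; rewrite gmeanS; last exact: tame_cst.
by rewrite IH Rintegral_cst//= probability_setT mulr1.
Qed.

Lemma gmeanD k f g : tame f -> tame g ->
  gmean k (fun z => f z + g z) = gmean k f + gmean k g.
Proof.
elim: k f g => // k IH f g tf tg; rewrite !gmeanS//; last exact: tameD.
rewrite -RintegralD//; [|exact: gmean_integrable..].
by apply: eq_Rintegral => x _; rewrite IH//; exact: tame_upd.
Qed.

Lemma gmeanZ k (c : R) f : tame f -> gmean k (fun z => c * f z) = c * gmean k f.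
Proof.
elim: k f => // k IH f tf; rewrite !gmeanS//; last exact: tameZ.
rewrite -RintegralZl//; last exact: gmean_integrable.
by apply: eq_Rintegral => x _; rewrite IH//; exact: tame_upd.
Qed.

Lemma gmean_sum k (I : Type) (r : seq I) (P : pred I) (F : I -> (nat -> R) -> R) :
  (forall i, P i -> tame (F i)) ->
  gmean k (fun z => \sum_(i <- r | P i) F i z) = \sum_(i <- r | P i) gmean k (F i).
Proof.
move=> tF; elim: r => [|i r IH].
  rewrite big_nil -[RHS](gmean_cst k); congr gmean.
  by apply/funext => z; rewrite big_nil.
rewrite big_cons -IH; have [Pi|nPi] := boolP (P i).
  rewrite -gmeanD//; [|exact: tF|exact: tame_sum].
  by congr gmean; apply/funext => z; rewrite big_cons Pi.
by congr gmean; apply/funext => z; rewrite big_cons (negbTE nPi).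
Qed.

Lemma le_gmean k f g : tame f -> tame g -> (forall z, f z <= g z) ->
  gmean k f <= gmean k g.
Proof.
elim: k f g => [|k IH] f g tf tg fg; first exact: fg.
rewrite !gmeanS//; apply: le_Rintegral => //; [exact: gmean_integrable..|].
by move=> x _; apply: IH => //; exact: tame_upd.
Qed.

End GaussExpect.

(** * Moments of linear forms in the noise *)

Section LinearForms.
Context {R : realType}.
Local Notation nu := (normal_prob (0 : R) 1).
Implicit Types (b z : nat -> R) (s : R) (k : nat).

Definition linform b k z : R := \sum_(i < k) b i * z i.

Lemma linformS b k z x :
  linform b k.+1 (upd z k x) = linform b k z + b k * x.
Proof.
rewrite /linform big_ord_recr /= /upd eqxx; congr (_ + _).
by apply: eq_bigr => i _; rewrite ltn_eqF.
Qed.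

Lemma cvg_sumr (I : Type) (r : seq I) (P : pred I) (F : I -> nat -> R) (l : I -> R) :
  (forall i, P i -> F i m @[m --> \oo] --> l i) ->
  \sum_(i <- r | P i) F i m @[m --> \oo] --> \sum_(i <- r | P i) l i.
Proof.
move=> h; elim: r => [|i r IH].
  by under eq_fun do rewrite big_nil; rewrite big_nil; exact: cvg_cst.
under eq_fun do rewrite big_cons; rewrite big_cons.
by case: ifP => [Pi|//]; apply: cvgD => //; exact: h.
Qed.

Lemma cvg_exprn (u : nat -> R) (l : R) p :
  u m @[m --> \oo] --> l -> u m ^+ p @[m --> \oo] --> l ^+ p.
Proof.
move=> ul; elim: p => [|p IH]; first by under eq_fun do rewrite expr0; exact: cvg_cst.
by under eq_fun do rewrite exprS; rewrite exprS; exact: cvgM.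
Qed.

Lemma linform_exp4_bound b k s : exists C,
  forall z, (s + linform b k z) ^+ 4 <= C * weight k z.
Proof.
elim: k => [|k [C IH]].
  by exists (s ^+ 4) => z; rewrite /linform /weight !big_ord0 addr0 mulr1.
exists (8 * C + 8 * b k ^+ 4) => z.
rewrite /linform /weight !big_ord_recr /= -/(linform _ _ _) -/(weight _ _).
have := IH z; have := weight_ge1 k z.
set X := linform _ _ _; set w := weight _ _; set y := z k => w1 Xw.
(* This is convexity of the fourth power, the difference being a square times a nonnegative
   quadratic form. *)
have conv (p q : R) : (p + q) ^+ 4 <= 8 * p ^+ 4 + 8 * q ^+ 4.
  rewrite -subr_ge0 [X in 0 <= X](_ : _ =
    (p - q) ^+ 2 * (5 * (p + q) ^+ 2 + 2 * p ^+ 2 + 2 * q ^+ 2)); last by ring.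
  apply: mulr_ge0; first exact: sqr_ge0.
  by have := sqr_ge0 (p + q); have := sqr_ge0 p; have := sqr_ge0 q; lra.
have y4 : 0 <= y ^+ 4 by rewrite exprn_even_ge0.
have b4 : 0 <= b k ^+ 4 by rewrite exprn_even_ge0.
have C0 : 0 <= C * w by rewrite (le_trans _ Xw)// exprn_even_ge0.
rewrite addrA (le_trans (conv _ _))// exprMn.
have h1 : 8 * (s + X) ^+ 4 <= 8 * (C * w) by lra.
have h2 : b k ^+ 4 * y ^+ 4 <= b k ^+ 4 * (w * (1 + y ^+ 4)).
  by rewrite ler_wpM2l// (le_trans (_ : _ <= 1 + y ^+ 4)) ?lerDr// ler_peMl//; lra.
have h3 : C * w <= C * w * (1 + y ^+ 4) by rewrite ler_peMr//; lra.
have -> : (8 * C + 8 * b k ^+ 4) * (w * (1 + y ^+ 4)) =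
    8 * (C * w * (1 + y ^+ 4)) + 8 * (b k ^+ 4 * (w * (1 + y ^+ 4))) by ring.
by apply: lerD; lra.
Qed.

Lemma tame_linform_exp b k s p : (p <= 4)%N ->
  tame (fun z => (s + linform b k z) ^+ p).
Proof.
move=> p4; split.
  move=> z_ z zz; apply: cvg_exprn; apply: cvgD; first exact: cvg_cst.
  by apply: cvg_sumr => i _; apply: cvgM; [exact: cvg_cst|exact: zz].
have [C HC] := linform_exp4_bound b k s.
exists k, (1 + C) => z; rewrite normrX mulrDl mul1r.
have w1 := weight_ge1 k z.
apply: (@le_trans _ _ (1 + (s + linform b k z) ^+ 4)); last by rewrite lerD.
rewrite -[X in 1 + X]ger0_norm ?exprn_even_ge0// normrX.
have [x1|x1] := leP `|s + linform b k z| 1.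
  by rewrite (le_trans (exprn_ile1 _ _ _))// lerDl exprn_ge0.
by rewrite (le_trans (ler_weXn2l (ltW x1) p4))// lerDr.
Qed.

(** The moments stay symbolic and end up in the universal constant. *)
Definition mom2 : R := (\int[nu]_x (x ^+ 2))%R.
Definition mom4 : R := (\int[nu]_x (x ^+ 4))%R.
(* The maximum avoids Jensen's inequality [mom2 ^+ 2 <= mom4]. *)
Definition mom4ub : R := Num.max mom4 (mom2 ^+ 2).

Lemma expr_bound (x : R) p : (p <= 4)%N -> `|x ^+ p| <= 1 * (1 + x ^+ 4).
Proof.
move=> p4; rewrite mul1r normrX -[x ^+ 4]ger0_norm ?exprn_even_ge0// normrX.
have [x1|x1] := leP `|x| 1.
  by rewrite (le_trans (exprn_ile1 _ _ _))// lerDl exprn_ge0.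
by rewrite (le_trans (ler_weXn2l (ltW x1) p4))// lerDr.
Qed.

Lemma integrable_normal_expr p : (p <= 4)%N ->
  nu.-integrable setT (EFin \o (fun x : R => x ^+ p)).
Proof.
move=> p4; apply: (integrable_normal_bound _ 1).
  exact: exprn_continuous.
by move=> x; exact: expr_bound.
Qed.

Lemma mom2_gt0 : 0 < mom2.
Proof.
rewrite /mom2 /Rintegral fine_gt0// integral_normal_sqr_gt0/=.
exact: integrable_lty (integrable_normal_expr 2 isT).
Qed.

Lemma integrable_normal_monom p (c : R) : (p <= 4)%N ->
  nu.-integrable setT (EFin \o (fun x : R => c * x ^+ p)).
Proof.
move=> p4; have := integrableZl measurableT c (integrable_normal_expr p p4).
by apply: eq_integrable => // x _; rewrite /= EFinM.
Qed.

Lemma integrable_normalD (g h : R -> R) : nu.-integrable setT (EFin \o g) ->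
  nu.-integrable setT (EFin \o h) ->
  nu.-integrable setT (EFin \o (fun x => g x + h x)).
Proof. by move=> ig ih; have := integrableD measurableT ig ih; exact: eq_integrable. Qed.

Lemma integrable_normal_poly4 (c0 c1 c2 c3 c4 : R) :
  nu.-integrable setT (EFin \o
    (fun x => c0 + c1 * x + c2 * x ^+ 2 + c3 * x ^+ 3 + c4 * x ^+ 4)).
Proof.
do 3 (apply: integrable_normalD; last exact: integrable_normal_monom).
apply: integrable_normalD; last exact: (integrable_normal_monom 1%N).
exact: finite_measure_integrable_cst.
Qed.

Lemma mom4ub_gt0 : 0 < mom4ub.
Proof.
rewrite (lt_le_trans (_ : 0 < mom2 ^+ 2)) ?exprn_gt0 ?mom2_gt0//.
by rewrite /mom4ub le_max lexx orbT.
Qed.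

Lemma Rintegral_normal_poly4 (c0 c1 c2 c3 c4 : R) :
  (\int[nu]_x (c0 + c1 * x + c2 * x ^+ 2 + c3 * x ^+ 3 + c4 * x ^+ 4))%R =
  c0 + c2 * mom2 + c4 * mom4.
Proof.
have odd p : (p <= 4)%N -> odd p -> (\int[nu]_x (x ^+ p))%R = 0.
  move=> p4 op; rewrite /Rintegral (integral_normal_odd (fun x => x ^+ p) 1)//.
  - exact: exprn_continuous.
  - by move=> x; exact: expr_bound.
  - by move=> x; rewrite exprNn -signr_odd op expr1 mulN1r.
have i1 : nu.-integrable setT (EFin \o (fun x : R => c1 * x)).
  exact: (integrable_normal_monom 1%N).
have i2 := integrable_normal_monom 2%N c2 isT.
have i3 := integrable_normal_monom 3%N c3 isT.
have i4 := integrable_normal_monom 4%N c4 isT.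
have i0 : nu.-integrable setT (EFin \o (fun _ : R => c0)).
  exact: finite_measure_integrable_cst.
have i01 := integrable_normalD _ _ i0 i1.
have i02 := integrable_normalD _ _ i01 i2.
have i03 := integrable_normalD _ _ i02 i3.
rewrite (RintegralD measurableT i03 i4) (RintegralD measurableT i02 i3).
rewrite (RintegralD measurableT i01 i2) (RintegralD measurableT i0 i1).
rewrite Rintegral_cst//= probability_setT mulr1.
rewrite !RintegralZl//; [|exact: integrable_normal_expr..|].
  rewrite -/mom2 -/mom4 (odd 3%N)// (_ : (\int[nu]_x x)%R = 0) ?(odd 1%N)//.
  by rewrite !mulr0 !addr0.
exact: (integrable_normal_expr 1%N).
Qed.

(** The offset s makes the induction work, here and for the higher powers: fixing the last variable
    at x turns it into s + b_k x. *)
Lemma gmean_linform b k s : gmean k (fun z => s + linform b k z) = s.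
Proof.
elim: k s => [|k IH] s.
  by rewrite /gmean /= /linform big_ord0 addr0.
rewrite gmeanS; last exact: (tame_linform_exp b k.+1 s 1).
transitivity (\int[nu]_x (s + b k * x + 0 * x ^+ 2 + 0 * x ^+ 3 + 0 * x ^+ 4))%R.
  apply: eq_Rintegral => x _; rewrite -[LHS](_ : gmean k (fun z =>
    s + b k * x + linform b k z) = _); first by rewrite IH; ring.
  by congr gmean; apply/funext => z; rewrite linformS; ring.
by rewrite Rintegral_normal_poly4; ring.
Qed.

Lemma gmean_linform_sqr b k s :
  gmean k (fun z => (s + linform b k z) ^+ 2) =
  s ^+ 2 + mom2 * \sum_(i < k) b i ^+ 2.
Proof.
elim: k s => [|k IH] s.
  by rewrite /gmean /= /linform !big_ord0 mulr0 !addr0.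
rewrite gmeanS; last exact: tame_linform_exp.
set v := \sum_(i < k) _ in IH.
transitivity (\int[nu]_x ((s ^+ 2 + mom2 * v) + 2 * s * b k * x + b k ^+ 2 * x ^+ 2
   + 0 * x ^+ 3 + 0 * x ^+ 4))%R.
  apply: eq_Rintegral => x _; rewrite -[LHS](_ : gmean k (fun z =>
    (s + b k * x + linform b k z) ^+ 2) = _); first by rewrite IH; ring.
  by congr gmean; apply/funext => z; rewrite linformS; ring.
by rewrite Rintegral_normal_poly4 big_ord_recr /= -/v; ring.
Qed.

(** Integrating out the last variable adds b^4 [mom4] and 6 b^2 v [mom2 ^+ 2]. Both are absorbed by
    the increment of 3 M v^2 to 3 M (v + b^2)^2, as M dominates [mom4] and [mom2 ^+ 2]. *)
Lemma gmean_linform_exp4 b k s :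
  gmean k (fun z => (s + linform b k z) ^+ 4) <=
  s ^+ 4 + 6 * s ^+ 2 * (mom2 * \sum_(i < k) b i ^+ 2) +
  3 * mom4ub * (\sum_(i < k) b i ^+ 2) ^+ 2.
Proof.
elim: k s => [|k IH] s.
  by rewrite /gmean /= /linform !big_ord0 expr0n /= !mulr0 !addr0.
have t4 := tame_linform_exp b k.+1 s 4 isT.
rewrite gmeanS//; set v := \sum_(i < k) _ in IH.
have v0 : 0 <= v by apply: sumr_ge0 => i _; rewrite sqr_ge0.
set M := mom4ub in IH *.
have M4 : mom4 <= M by rewrite /M /mom4ub le_max lexx.
have M2 : mom2 ^+ 2 <= M by rewrite /M /mom4ub le_max lexx orbT.
(* Coefficients, in powers of x, of the induction hypothesis at offset s + b_k x. *)
pose c0 := s ^+ 4 + 6 * s ^+ 2 * (mom2 * v) + 3 * M * v ^+ 2.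
pose c1 := 4 * s ^+ 3 * b k + 12 * s * b k * (mom2 * v).
pose c2 := 6 * s ^+ 2 * b k ^+ 2 + 6 * b k ^+ 2 * (mom2 * v).
pose c3 := 4 * s * b k ^+ 3.
pose c4 := b k ^+ 4.
apply: (@le_trans _ _
  (\int[nu]_x (c0 + c1 * x + c2 * x ^+ 2 + c3 * x ^+ 3 + c4 * x ^+ 4))%R).
  apply: le_Rintegral => //; first exact: (gmean_integrable k _ t4).
    exact: integrable_normal_poly4.
  move=> x _; rewrite -[leLHS](_ : gmean k (fun z =>
    (s + b k * x + linform b k z) ^+ 4) = _); last first.
    by congr gmean; apply/funext => z; rewrite linformS addrA addrAC.
  by rewrite (le_trans (IH _))// le_eqVlt; apply/orP; left; apply/eqP;
     rewrite /c0 /c1 /c2 /c3 /c4; ring.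
rewrite Rintegral_normal_poly4 big_ord_recr /= -/v /c0 /c2 /c4.
have b2 : 0 <= b k ^+ 2 by rewrite sqr_ge0.
have h1 : b k ^+ 4 * mom4 <= 3 * (b k ^+ 4 * M).
  have b4 : 0 <= b k ^+ 4 by rewrite exprn_even_ge0.
  have M0 : 0 <= M by rewrite (le_trans _ M2)// sqr_ge0.
  have : b k ^+ 4 * mom4 <= b k ^+ 4 * M by rewrite ler_wpM2l.
  have : 0 <= b k ^+ 4 * M by rewrite mulr_ge0.
  lra.
have h2 : (b k ^+ 2 * v) * mom2 ^+ 2 <= (b k ^+ 2 * v) * M.
  by rewrite ler_wpM2l// mulr_ge0.
rewrite -subr_ge0 [X in 0 <= X](_ : _ = (3 * (b k ^+ 4 * M) - b k ^+ 4 * mom4) +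
  6 * (b k ^+ 2 * v * M - b k ^+ 2 * v * mom2 ^+ 2)); last by ring.
by rewrite addr_ge0 ?mulr_ge0// ?subr_ge0.
Qed.

End LinearForms.

(** * Projection onto closed convex sets of grids *)

Section GridProjection.
Context {R : realType} {n : nat}.
Local Notation G := (grid R n).
Implicit Types (a b y p t : G) (C : set G).

Definition ip a b : R := \sum_(i < n) \sum_(j < n) a i j * b i j.

Definition gclosed C := forall (x_ : nat -> G) (x : G), (forall m, C (x_ m)) ->
  (forall i j, x_ m i j @[m --> \oo] --> x i j) -> C x.

Definition gseg a b (s : R) : G := fun i j => a i j + s * (b i j - a i j).

Definition gconvex C := forall a b (s : R), C a -> C b -> 0 <= s <= 1 ->
  C (gseg a b s).

Definition is_proj C y p := C p /\ forall t, C t -> frob2 y p <= frob2 y t.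

Lemma frob2_ge0 a b : 0 <= frob2 a b.
Proof. by apply: sumr_ge0 => i _; apply: sumr_ge0 => j _; exact: sqr_ge0. Qed.

Lemma frob2xx a : frob2 a a = 0.
Proof. by rewrite /frob2 big1// => i _; rewrite big1// => j _; rewrite subrr expr0n. Qed.

Lemma sqr_le_frob2 a b i j : (a i j - b i j) ^+ 2 <= frob2 a b.
Proof.
rewrite /frob2 (bigD1 i)//= (bigD1 j)//= -addrA lerDl addr_ge0//.
  by apply: sumr_ge0 => l _; exact: sqr_ge0.
by apply: sumr_ge0 => k _; apply: sumr_ge0 => l _; exact: sqr_ge0.
Qed.

Lemma frob2_eq0 a b : frob2 a b = 0 -> a = b.
Proof.
move=> h; apply/funext => i; apply/funext => j; apply/eqP.
by rewrite -subr_eq0 -sqrf_eq0 eq_le sqr_ge0 andbT -h sqr_le_frob2.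
Qed.

Lemma eq_sum2 (F H : 'I_n -> 'I_n -> R) : (forall i j, F i j = H i j) ->
  \sum_(i < n) \sum_(j < n) F i j = \sum_(i < n) \sum_(j < n) H i j.
Proof. by move=> e; apply: eq_bigr => i _; apply: eq_bigr => j _. Qed.

Lemma le_sum2 (F H : 'I_n -> 'I_n -> R) : (forall i j, F i j <= H i j) ->
  \sum_(i < n) \sum_(j < n) F i j <= \sum_(i < n) \sum_(j < n) H i j.
Proof. by move=> e; apply: ler_sum => i _; apply: ler_sum => j _. Qed.

Lemma sum2D (F H : 'I_n -> 'I_n -> R) :
  \sum_(i < n) \sum_(j < n) (F i j + H i j) =
  \sum_(i < n) \sum_(j < n) F i j + \sum_(i < n) \sum_(j < n) H i j.
Proof. by under eq_bigr do rewrite big_split/=; rewrite big_split. Qed.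

Lemma sum2Z (c : R) (F : 'I_n -> 'I_n -> R) :
  \sum_(i < n) \sum_(j < n) c * F i j = c * \sum_(i < n) \sum_(j < n) F i j.
Proof. by rewrite mulr_sumr; apply: eq_bigr => i _; rewrite mulr_sumr. Qed.

Lemma frob2_0r a : frob2 a (fun _ _ => 0) = ip a a.
Proof. by apply: eq_sum2 => i j; rewrite subr0 expr2. Qed.

Lemma cvg_frob2 (x_ y_ : nat -> G) a b :
  (forall i j, x_ m i j @[m --> \oo] --> a i j) ->
  (forall i j, y_ m i j @[m --> \oo] --> b i j) ->
  frob2 (x_ m) (y_ m) @[m --> \oo] --> frob2 a b.
Proof.
move=> xa yb; apply: cvg_sumr => i _; apply: cvg_sumr => j _.
by apply: cvg_exprn; apply: cvgB.
Qed.

Lemma parallelogram a b y :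
  frob2 a b + 4 * frob2 y (gseg a b 2^-1) = 2 * frob2 y a + 2 * frob2 y b.
Proof.
rewrite /frob2 -!sum2Z -!sum2D; apply: eq_sum2 => i j.
by rewrite /gseg; field.
Qed.

(** By the parallelogram identity a minimising sequence is Cauchy, since the midpoint of two of its
    terms is again at squared distance at least d. *)
Lemma proj_exists C y : C !=set0 -> gclosed C -> gconvex C ->
  exists p, is_proj C y p.
Proof.
move=> [t0 Ct0] clC cvC.
pose E := [set frob2 y t | t in C].
have hE : has_inf E.
  split; first by exists (frob2 y t0), t0.
  by exists 0 => _ [t _ <-]; exact: frob2_ge0.
pose d := inf E.
have dle t : C t -> d <= frob2 y t.
  by move=> Ct; apply: ge_inf; [exact: hE.2|exists t].
have ex m : exists t, C t /\ frob2 y t < d + m.+1%:R^-1.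
  have [|_ [t Ct <-] h] := @inf_adherent _ E (m.+1%:R^-1) _ hE.
    by rewrite invr_gt0.
  by exists t.
have [x_ hx] := choice ex.
have close m l : frob2 (x_ m) (x_ l) <= 2 * m.+1%:R^-1 + 2 * l.+1%:R^-1.
  have Cmid : C (gseg (x_ m) (x_ l) 2^-1).
    by apply: cvC; [exact: (hx m).1|exact: (hx l).1|apply/andP; split; lra].
  have := parallelogram (x_ m) (x_ l) y.
  move: (dle _ Cmid) (hx m).2 (hx l).2.
  set em := m.+1%:R^-1; set el := l.+1%:R^-1; lra.
have cv i j : cvg (x_ m i j @[m --> \oo]).
  apply: cauchy_cvg; apply: cauchy_exP => e e0.
  (* For m >= N, [close] bounds the squared distance to the N-th term by 4 / (N + 1), which must
     stay below e^2. *)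
  pose N := (Num.truncn (4 / e ^+ 2)).
  have e2 : 0 < e ^+ 2 by rewrite exprn_gt0.
  have HN : 4 / e ^+ 2 < N.+1%:R by exact: truncnS_gt.
  exists (x_ N i j); exists N => // m /= Nm.
  rewrite /ball /= -ltr_sqr ?nnegrE ?normr_ge0 ?(ltW e0)//.
  rewrite real_normK ?num_real//.
  apply: le_lt_trans (sqr_le_frob2 _ _ _ _) _.
  apply: le_lt_trans (close _ _) _.
  have : m.+1%:R^-1 <= N.+1%:R^-1 :> R by rewrite lef_pV2 ?posrE// ler_nat.
  have : 4 * N.+1%:R^-1 < e ^+ 2.
    by rewrite ltr_pdivrMr// mulrC -ltr_pdivrMr.
  set em := m.+1%:R^-1; set eN := N.+1%:R^-1; lra.
pose p : G := fun i j => lim (x_ m i j @[m --> \oo]).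
have xp i j : x_ m i j @[m --> \oo] --> p i j by exact: cv.
exists p; split; first by apply: (clC x_) => // m; exact: (hx m).1.
move=> t Ct; apply: le_trans (dle _ Ct).
have c1 : frob2 y (x_ m) @[m --> \oo] --> frob2 y p.
  by apply: (@cvg_frob2 (fun=> y)) => // i j; exact: cvg_cst.
have c2 : d + m.+1%:R^-1 @[m --> \oo] --> d.
  by rewrite -[X in _ --> X]addr0; apply: cvgD; [exact: cvg_cst|exact: cvg_harmonic].
by apply: (ler_cvg_to c1 c2); apply: nearW => m; exact: ltW (hx m).2.
Qed.

Lemma proj_angle C y p t : gconvex C -> is_proj C y p -> C t ->
  \sum_(i < n) \sum_(j < n) (y i j - p i j) * (t i j - p i j) <= 0.
Proof.
move=> cvC [Cp minp] Ct; set A := (X in X <= 0).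
have B0 := frob2_ge0 t p; set B := frob2 t p in B0.
rewrite leNgt; apply/negP => A0.
have AB : 0 < A + B by lra.
(* Moving from p towards t by s changes the squared distance by s (s B - 2 A), negative for this s.
   The denominator A + B keeps s in ]0, 1] and is positive even if B = 0. *)
pose s := A / (A + B).
have s0 : 0 < s by rewrite divr_gt0.
have s1 : s <= 1 by rewrite ler_pdivrMr// mul1r; lra.
have s01 : 0 <= s <= 1 by rewrite (ltW s0).
have := minp _ (cvC _ _ _ Cp Ct s01).
have -> : frob2 y (gseg p t s) = frob2 y p + - (2 * s) * A + s ^+ 2 * B.
  rewrite /frob2 /A /B /frob2 -!sum2Z -!sum2D; apply: eq_sum2 => i j.
  by rewrite /gseg; ring.
have sB : s * (A + B) = A by rewrite divfK// gt_eqF.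
have : s * (s * B - 2 * A) < 0.
  have sA : 0 < s * A by rewrite mulr_gt0.
  by rewrite pmulr_rlt0//; lra.
by rewrite !expr2; lra.
Qed.

(** The two angle conditions add up to |p - p'|^2 <= <y - y', p - p'>; expanding the square of (y -
    y') - (p - p') concludes. *)
Lemma proj_nonexpansive C y y' p p' : gconvex C ->
  is_proj C y p -> is_proj C y' p' -> frob2 p p' <= frob2 y y'.
Proof.
move=> cvC py py'.
have h1 := proj_angle _ _ _ _ cvC py py'.1.
have h2 := proj_angle _ _ _ _ cvC py' py.1.
have : 0 <= \sum_(i < n) \sum_(j < n) ((y i j - y' i j) - (p i j - p' i j)) ^+ 2.
  by apply: sumr_ge0 => i _; apply: sumr_ge0 => j _; exact: sqr_ge0.
suff -> : \sum_(i < n) \sum_(j < n) ((y i j - y' i j) - (p i j - p' i j)) ^+ 2 =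
    frob2 y y' + (-1) * frob2 p p' +
    2 * (\sum_(i < n) \sum_(j < n) (y i j - p i j) * (p' i j - p i j)) +
    2 * (\sum_(i < n) \sum_(j < n) (y' i j - p' i j) * (p i j - p' i j)) by lra.
by rewrite /frob2 -!sum2Z -!sum2D; apply: eq_sum2 => i j; ring.
Qed.

Lemma proj_unique C y p p' : gconvex C ->
  is_proj C y p -> is_proj C y p' -> p = p'.
Proof.
move=> cvC py py'; apply: frob2_eq0; apply/eqP; rewrite eq_le frob2_ge0 andbT.
by rewrite -(frob2xx y); exact: proj_nonexpansive cvC py py'.
Qed.

Lemma is_proj_self C y : C y -> is_proj C y y.
Proof. by move=> Cy; split=> // t _; rewrite frob2xx frob2_ge0. Qed.

(* [2 p] belonging to the cone gives <y, p> <= |p|^2. *)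
Lemma proj_cone_lower C y p t : gconvex C -> (forall u, C u -> C (fun i j => 2 * u i j)) ->
  is_proj C y p -> C t -> 2 * ip t y - ip t t <= ip p p.
Proof.
move=> cvC cone py Ct.
have h := proj_angle _ _ _ _ cvC py (cone _ py.1).
have := py.2 _ Ct.
have -> : frob2 y p = ip y y + (-2) * ip p y + ip p p.
  by rewrite /frob2 /ip -!sum2Z -!sum2D; apply: eq_sum2 => i j; ring.
have -> : frob2 y t = ip y y + (-2) * ip t y + ip t t.
  by rewrite /frob2 /ip -!sum2Z -!sum2D; apply: eq_sum2 => i j; ring.
suff : \sum_(i < n) \sum_(j < n) (y i j - p i j) * (2 * p i j - p i j) =
  ip p y + (-1) * ip p p by move: h => /[swap] ->; lra.
by rewrite /ip -!sum2Z -!sum2D; apply: eq_sum2 => i j; ring.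
Qed.

End GridProjection.

(** * The tangent cone at theta*, and the estimator for small noise *)

Section TangentCone.
Context {R : realType} {n : nat}.
Local Notation G := (grid R n).
Local Notation node := ('I_n * 'I_n)%type.
Local Notation th0 := (theta_star R n).
Local Notation V0 := (TV_norm (theta_star R n)).
Implicit Types (a b y p t : G).

(** Covers both [TV_norm] and its directional derivative, so that closedness and convexity of
    sublevel sets are proved once. *)
Definition edge_sum (H : node -> node -> R -> R) t : R :=
  \sum_(u : node) \sum_(v : node | grid_edge u v) H u v (t u.1 u.2 - t v.1 v.2).

Lemma edge_sum_closed H (c : R) : (forall u v, continuous (H u v)) ->
  gclosed [set t | edge_sum H t <= c].
Proof.
move=> cH x_ x xc xx /=.
have cv : edge_sum H (x_ m) @[m --> \oo] --> edge_sum H x.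
  apply: cvg_sumr => u _; apply: cvg_sumr => v _.
  by apply: continuous_cvg; [exact: cH|apply: cvgB].
by apply: (cvgr_to_le cv); exact: nearW.
Qed.

Lemma edge_sum_convex H (c : R) :
  (forall u v (x y s : R), 0 <= s <= 1 ->
     H u v (x + s * (y - x)) <= H u v x + s * (H u v y - H u v x)) ->
  gconvex [set t | edge_sum H t <= c].
Proof.
move=> cH a b s /= ac bc s01.
apply: (@le_trans _ _ (edge_sum H a + s * (edge_sum H b - edge_sum H a))).
  rewrite /edge_sum -sumrB mulr_sumr -big_split/=; apply: ler_sum => u _.
  rewrite -sumrB mulr_sumr -big_split/=; apply: ler_sum => v _.
  apply: le_trans (cH _ _ _ _ _ s01); rewrite le_eqVlt; apply/orP; left.
  by apply/eqP; congr H; rewrite /gseg; ring.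
move: s01 => /andP[s0 s1].
have h1 : 0 <= (1 - s) * (c - edge_sum H a) by rewrite mulr_ge0// subr_ge0.
have h2 : 0 <= s * (c - edge_sum H b) by rewrite mulr_ge0// subr_ge0.
by lra.
Qed.

Lemma norm_convex (x y s : R) : 0 <= s <= 1 ->
  `|x + s * (y - x)| <= `|x| + s * (`|y| - `|x|).
Proof.
move=> /andP[s0 s1]; have -> : x + s * (y - x) = (1 - s) * x + s * y by ring.
have h1 : `|(1 - s) * x| = (1 - s) * `|x| by rewrite normrM ger0_norm// subr_ge0.
have h2 : `|s * y| = s * `|y| by rewrite normrM ger0_norm.
by have := ler_normD ((1 - s) * x) (s * y); rewrite h1 h2; lra.
Qed.

Lemma TV_normE t : TV_norm t = edge_sum (fun _ _ x => n%:R^-1 * `|x|) t.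
Proof.
by rewrite /TV_norm mulr_sumr; apply: eq_bigr => u _; rewrite mulr_sumr.
Qed.

Lemma TV_closed (V : R) : gclosed [set t : G | TV_norm t <= V].
Proof.
under eq_set do rewrite TV_normE; apply: edge_sum_closed => u v x.
by apply: cvgM; [exact: cvg_cst|exact: norm_continuous].
Qed.

Lemma TV_convex (V : R) : gconvex [set t : G | TV_norm t <= V].
Proof.
under eq_set do rewrite TV_normE; apply: edge_sum_convex => u v x y s s01.
have := ler_wpM2l (_ : 0 <= n%:R^-1 :> R) (norm_convex x y s s01).
by rewrite invr_ge0 ler0n => /(_ isT); lra.
Qed.

Lemma theta_starP i j : th0 i j = 0 \/ th0 i j = 1.
Proof. by rewrite /theta_star; case: ifP; [right|left]. Qed.

(* [TV_dir] is the one-sided directional derivative of [n * TV_norm] at theta*. *)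
Definition dir_term (d x : R) : R := if d == 0 then `|x| else d * x.

Definition TV_dir : G -> R :=
  edge_sum (fun u v => dir_term (th0 u.1 u.2 - th0 v.1 v.2)).

Definition tangent : set G := [set t | TV_dir t <= 0].

Lemma tangent_closed : gclosed tangent.
Proof.
apply: (@edge_sum_closed _ 0) => u v x; set d := _ - _.
have -> : dir_term d = if d == 0 then Num.norm else *%R d.
  by apply/funext => y; rewrite /dir_term; case: ifP.
case: ifP => _; first exact: norm_continuous.
by apply: cvgM; [exact: cvg_cst|exact: cvg_id].
Qed.

Lemma tangent_convex : gconvex tangent.
Proof.
apply: (@edge_sum_convex _ 0) => u v x y s s01; rewrite /dir_term.
by case: ifP => _; [exact: norm_convex|lra].
Qed.

Lemma tangent0 : tangent (fun _ _ => 0).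
Proof.
rewrite /tangent /= /TV_dir /edge_sum big1// => u _; rewrite big1// => v _.
by rewrite /dir_term subrr normr0 mulr0 if_same.
Qed.

Lemma tangent_double t : tangent t -> tangent (fun i j => 2 * t i j).
Proof.
rewrite /tangent /= => h.
suff -> : TV_dir (fun i j => 2 * t i j) = 2 * TV_dir t by lra.
rewrite /TV_dir /edge_sum mulr_sumr; apply: eq_bigr => u _.
rewrite mulr_sumr; apply: eq_bigr => v _; rewrite /dir_term -mulrBr.
by case: ifP => _; [rewrite normrM ger0_norm|rewrite mulrCA].
Qed.

Lemma theta_star_diff u v : let d := th0 u.1 u.2 - th0 v.1 v.2 in
  d = 0 \/ d ^+ 2 = 1.
Proof.
move=> d; rewrite /d; case: (theta_starP u.1 u.2) => ->;
  case: (theta_starP v.1 v.2) => ->; [left|right|right|left]; ring.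
Qed.

(** On a jump edge |d| = 1, so |y| >= d y; take y = d + s x. The condition [d ^+ 2 = 1] treats both
    signs at once. *)
Lemma norm_dir_ge (d x s : R) : d = 0 \/ d ^+ 2 = 1 -> 0 <= s ->
  `|d| + s * dir_term d x <= `|d + s * x|.
Proof.
rewrite /dir_term => -[->|d1] s0.
  by rewrite eqxx normr0 !add0r normrM (ger0_norm s0).
have n1 : `|d| = 1.
  by apply/eqP; rewrite -(@eqrXn2 _ 2)// -normrX d1 expr1n normr1.
have -> : (d == 0) = false by apply/eqP => d0; move: d1; rewrite d0; lra.
have := ler_norm (d * (d + s * x)); rewrite normrM n1 mul1r.
by apply: le_trans; rewrite mulrDr -expr2 d1 mulrCA.
Qed.

(** On a jump edge, |s x| <= 1 = |d| keeps d + s x from crossing 0, so the absolute value stays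
    linear. *)
Lemma norm_dir_eq (d x s : R) : d = 0 \/ d ^+ 2 = 1 -> 0 <= s -> (s * x) ^+ 2 <= 1 ->
  `|d + s * x| = `|d| + s * dir_term d x.
Proof.
rewrite /dir_term => -[->|d1] s0 sx.
  by rewrite eqxx normr0 !add0r normrM (ger0_norm s0).
have n1 : `|d| = 1.
  by apply/eqP; rewrite -(@eqrXn2 _ 2)// -normrX d1 expr1n normr1.
have -> : (d == 0) = false by apply/eqP => d0; move: d1; rewrite d0; lra.
have p0 : 0 <= d * (d + s * x).
  have : `|d * (s * x)| <= 1.
    by rewrite normrM n1 mul1r -(@ler_pXn2r _ 2)// ?nnegrE// -normrX expr1n ger0_norm ?sqr_ge0.
  by rewrite ler_norml mulrDr -expr2 d1 => /andP[]; lra.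
have := ger0_norm p0; rewrite normrM n1 mul1r => ->.
by rewrite mulrDr -expr2 d1 mulrCA.
Qed.

Local Notation shift s t := (fun i j => th0 i j + s * t i j).

Lemma TV_shift_ge (s : R) t : 0 <= s ->
  V0 + n%:R^-1 * (s * TV_dir t) <= TV_norm (shift s t : G).
Proof.
move=> s0; rewrite /TV_norm -mulrDr ler_wpM2l ?invr_ge0//.
rewrite /TV_dir /edge_sum mulr_sumr -big_split/=; apply: ler_sum => u _.
rewrite mulr_sumr -big_split/=; apply: ler_sum => v _.
apply: le_trans (norm_dir_ge _ _ _ (theta_star_diff u v) s0) _.
by rewrite le_eqVlt; apply/orP; left; apply/eqP; congr `|_|; ring.
Qed.

Lemma TV_shift_eq (s : R) t : 0 <= s ->
  (forall i j k l, (s * (t i j - t k l)) ^+ 2 <= 1) ->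
  TV_norm (shift s t : G) = V0 + n%:R^-1 * (s * TV_dir t).
Proof.
move=> s0 h; rewrite /TV_norm -mulrDr; congr (_ * _).
rewrite /TV_dir /edge_sum mulr_sumr -big_split/=; apply: eq_bigr => u _.
rewrite mulr_sumr -big_split/=; apply: eq_bigr => v _.
rewrite -norm_dir_eq//; last exact: theta_star_diff.
by congr `|_|; ring.
Qed.

(** By convexity the constraint set lies in theta* + T everywhere, not only near theta*. It is
    therefore enough that the one point theta* + s p be feasible. It is so for small s, because |p|
    <= |t| and the total variation is linear along directions that small. *)
Lemma proj_shift (s : R) t p : (0 < n)%N -> 0 < s -> s ^+ 2 * (4 * ip t t) <= 1 ->
  is_proj tangent t p -> is_proj [set q : G | TV_norm q <= V0] (shift s t) (shift s p).
Proof.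
move=> n0 s0 st pt.
have frobE q q' : frob2 (shift s q : G) (shift s q') = s ^+ 2 * frob2 q q'.
  by rewrite /frob2 -sum2Z; apply: eq_sum2 => i j; ring.
have small : ip p p <= ip t t.
  rewrite -!frob2_0r.
  exact: proj_nonexpansive tangent_convex pt (is_proj_self _ _ tangent0).
have p2 i j : p i j ^+ 2 <= ip p p.
  by have := sqr_le_frob2 p (fun _ _ => 0) i j; rewrite subr0 frob2_0r.
have s20 : 0 < s ^+ 2 by rewrite exprn_gt0.
split=> [|q /= qV].
  rewrite /= TV_shift_eq ?(ltW s0)//; last first.
    (* The factor 4 of the smallness condition: (p_ij - p_kl)^2 <= 2 p_ij^2 + 2 p_kl^2 <= 4
       |p|^2. *)
    move=> i j k l; rewrite exprMn; apply: le_trans st; rewrite ler_pM2l//.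
    have := sqr_ge0 (p i j + p k l); have := p2 i j; have := p2 k l.
    by move: small; rewrite !expr2; lra.
  rewrite gerDl pmulr_rle0 ?invr_gt0 ?ltr0n// pmulr_rle0//; exact: pt.1.
(* Any feasible q is written as theta* plus s times a direction, which [TV_shift_ge] then places in
   the cone. *)
have qE : q = shift s (fun i j => s^-1 * (q i j - th0 i j)).
  by apply/funext => i; apply/funext => j; field; rewrite gt_eqF.
rewrite qE !frobE ler_pM2l//; apply: pt.2.
have := TV_shift_ge s (fun i j => s^-1 * (q i j - th0 i j)) (ltW s0).
rewrite -qE => h; have : n%:R^-1 * (s * TV_dir (fun i j => s^-1 * (q i j - th0 i j))) <= 0.
  by rewrite -(lerD2l V0) addr0 (le_trans h).
by rewrite pmulr_rle0 ?invr_gt0 ?ltr0n// pmulr_rle0.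
Qed.

(** [get] returns a minimiser only if there is one; existence comes from [proj_exists], theta* being
    feasible. *)
Lemma tvd_estP y : is_proj [set q : G | TV_norm q <= V0] y (tvd_est V0 y).
Proof.
apply: (@getPex _ [set p : G | is_TVD_min V0 y p]).
apply: proj_exists; [by exists th0 => /=|exact: TV_closed|exact: TV_convex].
Qed.

Definition cone_proj y : G := get [set p | is_proj tangent y p].

Lemma cone_projP y : is_proj tangent y (cone_proj y).
Proof.
apply: (@getPex _ [set p : G | is_proj tangent y p]).
by apply: proj_exists; [exists (fun _ _ => 0); exact: tangent0|
  exact: tangent_closed|exact: tangent_convex].
Qed.

Lemma tvd_est_shift (s : R) t : (0 < n)%N -> 0 < s -> s ^+ 2 * (4 * ip t t) <= 1 ->
  frob2 (tvd_est V0 (shift s t)) th0 = s ^+ 2 * ip (cone_proj t) (cone_proj t).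
Proof.
move=> n0 s0 st.
have := proj_unique _ _ _ _ (TV_convex V0) (tvd_estP (shift s t))
  (proj_shift _ _ _ n0 s0 st (cone_projP t)).
by move=> ->; rewrite /frob2 /ip -sum2Z; apply: eq_sum2 => i j; ring.
Qed.

End TangentCone.

(** * The limit of the normalised risk as sigma tends to 0 *)

Section RiskLimit.
Context {R : realType} {n : nat}.
Local Notation G := (grid R n).
Local Notation th0 := (theta_star R n).
Local Notation V0 := (TV_norm (theta_star R n)).
Implicit Types (z : nat -> R) (s : R).

Lemma cvg_sqr_dist (u e : nat -> R) (l : R) :
  (forall m, (u m - l) ^+ 2 <= e m) -> e m @[m --> \oo] --> 0 ->
  u m @[m --> \oo] --> l.
Proof.
move=> ue e0; apply/cvgrPdist_lt => r r0.
have r20 : 0 < r ^+ 2 by rewrite exprn_gt0.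
have [N _ hN] := cvgr_lt _ e0 _ r20; exists N => // m /hN em.
rewrite /= -ltr_sqr ?nnegrE ?(ltW r0)// real_normK ?num_real// -sqrrN opprB.
exact: le_lt_trans (ue m) em.
Qed.

(** Each entry of the projection moves by at most the Frobenius distance between the two inputs. *)
Lemma seqcont_proj (C : set G) (P : G -> G) (y : (nat -> R) -> G) (c : G) :
  gconvex C -> (forall t, is_proj C t (P t)) ->
  (forall i j, seqcont (fun z => y z i j)) ->
  seqcont (fun z => frob2 (P (y z)) c).
Proof.
move=> cvC PP yc z_ z zz.
apply: (@cvg_frob2 _ _ (fun m => P (y (z_ m))) (fun=> c)) => i j; last exact: cvg_cst.
apply: (cvg_sqr_dist _ (fun m => frob2 (y (z_ m)) (y z))).
  move=> m; apply: le_trans (sqr_le_frob2 (P (y (z_ m))) (P (y z)) i j) _.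
  exact: proj_nonexpansive cvC (PP _) (PP _).
rewrite -(frob2xx (y z)); apply: (@cvg_frob2 _ _ (fun m => y (z_ m)) (fun=> y z)).
  by move=> k l; exact: yc.
by move=> k l; exact: cvg_cst.
Qed.

Lemma factor_le_weight K p z : (p < K)%N -> 1 + z p ^+ 4 <= weight K z.
Proof.
move=> pK; rewrite /weight (bigD1 (Ordinal pK))//= ler_peMr//.
  by rewrite (le_trans _ (factor_ge1 _)).
elim/big_ind: _ => // [x y x1 y1|i _]; last exact: factor_ge1.
by rewrite -[1]mulr1 ler_pM.
Qed.

Lemma noise_index_lt (i j : 'I_n) : (i * n + j < n ^ 2)%N.
Proof.
rewrite expnS expn1 (@leq_trans (i.+1 * n))//; last by rewrite leq_mul2r ltn_ord orbT.
by rewrite mulSn addnC ltn_add2r.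
Qed.

Lemma ip_noise_le z : ip (noise z : G) (noise z) <= (n ^ 2)%:R * weight (n ^ 2) z.
Proof.
apply: (@le_trans _ _ (\sum_(i < n) \sum_(j < n) weight (n ^ 2) z)).
  apply: le_sum2 => i j; rewrite /noise -expr2.
  apply: le_trans (factor_le_weight _ _ _ (noise_index_lt i j)).
  set x := z _; have := sqr_ge0 (x ^+ 2 - 2^-1).
  by rewrite (_ : x ^+ 4 = (x ^+ 2) ^+ 2) -?exprM// !expr2; lra.
rewrite !sumr_const !card_ord -mulrnA mulnn.
by rewrite mulr_natl.
Qed.

Definition risk s z : R :=
  frob2 (tvd_est V0 (fun i j => th0 i j + s * noise z i j)) th0.

Definition limit_risk z : R :=
  ip (cone_proj (noise z : G)) (cone_proj (noise z : G)).

Lemma limit_riskE z : limit_risk z = frob2 (cone_proj (noise z : G)) (fun _ _ => 0).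
Proof. by rewrite frob2_0r. Qed.

Lemma risk_le s z : risk s z <= s ^+ 2 * ip (noise z : G) (noise z).
Proof.
have h0 : is_proj [set q : G | TV_norm q <= V0] th0 th0 by apply: is_proj_self => /=.
apply: le_trans (proj_nonexpansive _ _ _ _ _ (TV_convex V0) (tvd_estP _) h0) _.
rewrite le_eqVlt; apply/orP; left; apply/eqP.
by rewrite /frob2 /ip -sum2Z; apply: eq_sum2 => i j; ring.
Qed.

Lemma limit_risk_le z : limit_risk z <= ip (noise z : G) (noise z).
Proof.
rewrite limit_riskE -frob2_0r.
exact: proj_nonexpansive tangent_convex (cone_projP _) (is_proj_self _ _ tangent0).
Qed.

Lemma seqcont_risk s : seqcont (risk s).
Proof.
apply: (seqcont_proj _ _ (fun z i j => th0 i j + s * noise z i j) _ (TV_convex V0) tvd_estP).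
move=> i j z_ z zz; apply: cvgD; first exact: cvg_cst.
by apply: cvgM; [exact: cvg_cst|exact: zz].
Qed.

Lemma seqcont_limit_risk : seqcont limit_risk.
Proof.
rewrite (_ : limit_risk = fun z => frob2 (cone_proj (noise z : G)) (fun _ _ => 0)).
  apply: (seqcont_proj _ _ (fun z => noise z) _ tangent_convex cone_projP).
  by move=> i j z_ z zz; exact: zz.
by apply/funext => z; exact: limit_riskE.
Qed.

Lemma dominated_limit_risk : dominated (n ^ 2) (n ^ 2)%:R limit_risk.
Proof.
move=> z; rewrite ger0_norm; first exact: le_trans (limit_risk_le z) (ip_noise_le z).
by rewrite limit_riskE frob2_ge0.
Qed.

Lemma tame_limit_risk : tame limit_risk.
Proof.
split; first exact: seqcont_limit_risk.
by exists (n ^ 2)%N, (n ^ 2)%:R; exact: dominated_limit_risk.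
Qed.

Lemma dominated_risk s : dominated (n ^ 2) (s ^+ 2 * (n ^ 2)%:R) (risk s).
Proof.
move=> z; rewrite ger0_norm ?frob2_ge0// -mulrA; apply: le_trans (risk_le s z) _.
by rewrite ler_wpM2l ?sqr_ge0// ip_noise_le.
Qed.

(** After division by s^2 the bound [risk_le] is free of s, which provides the domination. For fixed
    z the quotient is eventually equal to [limit_risk z], by [tvd_est_shift]. *)
Lemma risk_limit : (0 < n)%N ->
  ((s ^-2)%:E * MSE_tvd V0 s th0)%E @[s --> 0^'+] -->
  (gmean (n ^ 2) limit_risk * (n ^ 2)%:R^-1)%:E.
Proof.
move=> n0; apply/cvge_at_rightP => u [u0 ucv].
have E m : ((u m ^-2)%:E * MSE_tvd V0 (u m) th0)%E =
    (gmean (n ^ 2) (fun z => u m ^-2 * risk (u m) z) * (n ^ 2)%:R^-1)%:E.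
  have tr : tame (risk (u m)).
    split; first exact: seqcont_risk.
    by exists (n ^ 2)%N, (u m ^+ 2 * (n ^ 2)%:R); exact: dominated_risk.
  by rewrite /MSE_tvd (gauss_expect_tame _ _ tr) gmeanZ// -!EFinM mulrA.
under eq_fun do rewrite E.
apply: cvg_EFin; first exact: nearW.
apply: cvgM; last exact: cvg_cst.
have u20 m : 0 < u m ^+ 2 by rewrite exprn_gt0.
apply: (gmean_cvg _ (n ^ 2) (n ^ 2)%:R).
- move=> m z_ z zz; apply: cvgM; first exact: cvg_cst.
  exact: seqcont_risk.
- move=> m z; rewrite normrM gtr0_norm ?invr_gt0// mulrC ler_pdivrMr//.
  by apply: le_trans (dominated_risk (u m) z) _; rewrite -mulrA mulrC.
- exact: seqcont_limit_risk.
- exact: dominated_limit_risk.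
move=> z.
pose c := 4 * ip (noise z : G) (noise z).
have c_cvg : u m ^+ 2 * c @[m --> \oo] --> (0 : R).
  rewrite -(mul0r c); apply: cvgM; last exact: cvg_cst.
  by rewrite -[X in _ --> X](expr0n _ 2); exact: cvg_exprn.
apply: cvg_near_cst; have [N _ hN] := cvgr_le _ c_cvg 1 ltr01; exists N => // m /hN h.
rewrite /risk tvd_est_shift//; rewrite mulrA mulVf ?mul1r// gt_eqF//.
Qed.

Lemma limit_risk_ge (v : G) z : tangent v ->
  2 * ip v (noise z) - ip v v <= limit_risk z.
Proof.
move=> Tv; apply: (proj_cone_lower tangent) => //; first exact: tangent_convex.
- exact: tangent_double.
- exact: cone_projP.
Qed.

End RiskLimit.

(** * The test direction in the tangent cone *)

Section LowerBound.
Context {R : realType}.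
Implicit Types (z : nat -> R).

Lemma sum_mulord (F : nat -> R) k n :
  \sum_(i < k) \sum_(j < n) F (i * n + j)%N = \sum_(p < k * n) F p.
Proof.
elim: k => [|k IH]; first by rewrite mul0n !big_ord0.
by rewrite big_ord_recr /= IH mulSnr big_split_ord.
Qed.

Lemma sum_noise n (c : nat -> nat -> R) z :
  \sum_(i < n) \sum_(j < n) c i j * (noise z : grid R n) i j =
  linform (fun p => c (p %/ n)%N (p %% n)%N) (n ^ 2) z.
Proof.
rewrite /linform -mulnn -(sum_mulord (fun p => c (p %/ n)%N (p %% n)%N * z p)).
apply: eq_sum2 => i j; have n0 : (0 < n)%N by case: n i {j} => [[]|].
by rewrite divnMDl// divn_small// addn0 modnMDl modn_small.
Qed.

Lemma sum_noise_sqr n (c : nat -> nat -> R) :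
  \sum_(p < n ^ 2) c (p %/ n)%N (p %% n)%N ^+ 2 =
  \sum_(i < n) \sum_(j < n) c i j ^+ 2.
Proof.
rewrite -mulnn -(sum_mulord (fun p => c (p %/ n)%N (p %% n)%N ^+ 2)).
apply: eq_sum2 => i j; have n0 : (0 < n)%N by case: n i {j} => [[]|].
by rewrite divnMDl// divn_small// addn0 modnMDl modn_small.
Qed.

(** With t = tau |x| the difference is |x| (1 - t + t^3), nonnegative for t >= 0. *)
Lemma norm_ge_poly (tau x : R) : 0 <= tau ->
  tau * x ^+ 2 - tau ^+ 3 * x ^+ 4 <= `|x|.
Proof.
move=> tau0; have e2 : x ^+ 2 = `|x| ^+ 2 by rewrite real_normK ?num_real.
have e4 : x ^+ 4 = `|x| ^+ 4 by rewrite -normrX ger0_norm ?exprn_even_ge0.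
rewrite e2 e4; set a := `|x|; have a0 : 0 <= a by exact: normr_ge0.
rewrite -subr_ge0 [X in 0 <= X](_ : _ = a * (1 - tau * a + (tau * a) ^+ 3)); last by ring.
rewrite mulr_ge0//; set t := tau * a; have t0 : 0 <= t by rewrite mulr_ge0.
have [t1|t1] := leP t 1; first by have := exprn_ge0 3 t0; lra.
have : t <= t ^+ 3 by rewrite ler_eXnr// ltW.
lra.
Qed.

Lemma ltn_half_lt n : (n./2 < n)%N = (0 < n)%N.
Proof. by case: n => // n; rewrite ltn_half_double -addnn addnS ltnS leq_addr. Qed.

Section Profile.
Context {n : nat}.
Local Notation node := ('I_n * 'I_n)%type.
Variables (n2 : (1 < n)%N) (l : nat) (l0 : (0 < l)%N) (h : R) (h0 : 0 <= h).
Variables (w : nat -> R) (w0 : forall B, 0 <= w B) (wh : forall B, w B <= 2 * h).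

(** The last column where theta* is 0, with columns counted from 0; [n2] makes the left half
    nonempty, so the predecessor is a true one. *)
Let m : nat := n./2.-1.
Let c : R := 2 * h / l%:R.

(* Adding [c] to the whole left half lowers the jump by [c] in each of the [n]
   rows; this pays for the vertical variation of the bumps [w] put on the last
   left column, whose horizontal variation is free because [w >= 0]. *)
Definition profile : grid R n := fun i j =>
  (if (j < n./2)%N then c else 0) + (if j == m :> nat then w (i %/ l)%N else 0).

Let half0 : (0 < n./2)%N. Proof. by rewrite half_gt0. Qed.
Let halfn : (n./2 < n)%N. Proof. by rewrite ltn_half_lt ltnW. Qed.
Let mS : m.+1 = n./2. Proof. exact: prednK. Qed.
Let c0 : 0 <= c. Proof. by rewrite /c divr_ge0// mulr_ge0. Qed.

Let theta_lt (i j : 'I_n) : theta_star R n i j = if (j < n./2)%N then 0 else 1.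
Proof.
rewrite /theta_star mul2n; have -> : (n < j.+1.*2)%N = ~~ (j < n./2)%N.
  by rewrite geq_half_double ltnNge.
by rewrite if_neg.
Qed.

Definition hor (u v : node) := (u.1 == v.1 :> nat) && (v.2 == u.2.+1 :> nat).
Definition ver (u v : node) := (u.2 == v.2 :> nat) && (v.1 == u.1.+1 :> nat).

Let T (u v : node) : R := dir_term (theta_star R n u.1 u.2 - theta_star R n v.1 v.2)
  (profile u.1 u.2 - profile v.1 v.2).

(** The edge into the bump column costs w; the edge out of it is a jump edge and gains c + w. A row
    therefore nets at most - c. *)
Let horE (i j j' : 'I_n) : j' = j.+1 :> nat ->
  T (i, j) (i, j') <=
  (if j.+1 == m then w (i %/ l)%N else 0) - (if j == m :> nat then c + w (i %/ l)%N else 0).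
Proof.
move=> jj; rewrite /T /= !theta_lt /profile jj -mS !ltnS.
have [jm|jm|jm] := ltngtP j m.
- rewrite subrr /dir_term eqxx addr0 opprD addrA subrr add0r normrN subr0.
  by rewrite ger0_norm//; case: eqP.
- by rewrite gtn_eqF ?(ltn_trans jm)// !addr0 !subrr /dir_term eqxx normr0.
- rewrite jm gtn_eqF// !addr0 subr0 !sub0r /dir_term.
  by rewrite oppr_eq0 oner_eq0 mulN1r.
Qed.

(** Along the bump column w changes only where a new block starts, and there by at most 2 h, both
    values lying in [0, 2 h]. *)
Let verE (i i' j : 'I_n) : i' = i.+1 :> nat ->
  T (i, j) (i', j) <=
  (if j == m :> nat then (if (l %| i.+1)%N then 2 * h else 0) else 0).
Proof.
move=> ii; rewrite /T /= !theta_lt subrr /dir_term eqxx /profile ii.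
case: eqP => _; last by rewrite subrr normr0.
rewrite opprD addrACA subrr add0r.
case: ifP => [_|ndv].
  by rewrite ler_norml; have := w0 (i %/ l)%N; have := w0 (i.+1 %/ l)%N;
    have := wh (i %/ l)%N; have := wh (i.+1 %/ l)%N; lra.
by rewrite divnS// ndv add0n subrr normr0.
Qed.

(** Summing over the rows gives at most - c n plus 2 h for each multiple of l in 1..n, that is - 2 h
    n / l + 2 h floor(n / l) <= 0. *)
Lemma profile_tangent : tangent profile.
Proof.
rewrite /tangent /= /TV_dir /edge_sum.
pose hb (u : node) : R := (if u.2.+1 == m then w (u.1 %/ l)%N else 0)
  - (if u.2 == m :> nat then c + w (u.1 %/ l)%N else 0).
pose vb (u : node) : R :=
  if u.2 == m :> nat then (if (l %| u.1.+1)%N then 2 * h else 0) else 0.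
have H u : \sum_(v | grid_edge u v) T u v <= hb u + vb u.
  rewrite (bigID (hor u))/=; apply: lerD.
    rewrite (eq_bigl (hor u)); last first.
      by move=> v; rewrite /grid_edge -/(hor u v) andbC; case: (hor u v).
    case: u => i j; have [jn|jn] := ltnP j.+1 n.
      rewrite (big_pred1 (i, Ordinal jn)) ?horE// => -[i' j'].
      by rewrite /hor /= [RHS]xpair_eqE -!val_eqE /= [i' == i :> nat]eq_sym.
    rewrite big_pred0 => [|[i' j']]; last first.
      by rewrite /hor /= [_ == j.+1]ltn_eqF ?andbF// (leq_trans (ltn_ord j')).
    (* The last column lies beyond m, so [hb] is 0 there and claims no gain from a missing edge. *)
    have jm : (m < j)%N by rewrite -ltnS (leq_trans _ jn)// mS.
    by rewrite /hb /= !gtn_eqF ?subr0// (ltn_trans jm).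
  rewrite (eq_bigl (ver u)); last first.
    move=> v; rewrite /grid_edge -/(hor u v) -/(ver u v).
    rewrite andb_orl andbN orFb /hor /ver.
    case: (u.2 =P v.2 :> nat) => [->|]//=.
    by rewrite (@ltn_eqF v.2)// andbF andbT.
  case: u => i j; have [ii|ii] := ltnP i.+1 n.
    rewrite (big_pred1 (Ordinal ii, j)) ?verE// => -[i' j'].
    by rewrite /ver /= [RHS]xpair_eqE -!val_eqE /= [j' == j :> nat]eq_sym andbC.
  rewrite big_pred0 => [|[i' j']]; last first.
    by rewrite /ver /= [_ == i.+1]ltn_eqF ?andbF// (leq_trans (ltn_ord i')).
  by rewrite /vb; do 2 case: ifP => // _; rewrite mulr_ge0.
apply: le_trans (ler_sum _ (fun u _ => H u)) _.
rewrite -(pair_big predT predT (fun i j => hb (i, j) + vb (i, j)))/=.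
have mn : (m < n)%N by rewrite (leq_ltn_trans _ halfn)// -mS.
have pick (F : R) : \sum_(j < n) (if j == m :> nat then F else 0) = F.
  by rewrite -big_mkcond (big_pred1 (Ordinal mn)).
have row (i : 'I_n) : \sum_(j < n) (hb (i, j) + vb (i, j)) <=
    - c + (if (l %| i.+1)%N then 2 * h else 0).
  rewrite /hb /vb /= big_split /= pick lerD2r sumrB pick lerBlDr addrA addNr add0r.
  (* If m = 0 no edge enters the bump column, and the sum of entering costs is empty. *)
  rewrite -big_mkcond /=; case: (posnP m) => m0.
    by rewrite big_pred0// => j; rewrite m0.
  have m1n : (m.-1 < n)%N by rewrite (leq_ltn_trans (leq_pred _)).
  rewrite (big_pred1 (Ordinal m1n))// => j.
  by rewrite /= -val_eqE /= -{1}(prednK m0) eqSS.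
apply: le_trans (ler_sum _ (fun i _ => row i)) _.
rewrite big_split /= sumr_const card_ord -big_mkcond/= sumr_const.
have -> : #|[pred i : 'I_n | (l %| i.+1)%N]| = (n %/ l)%N.
  rewrite divn_count_dvd big_add1 /= big_mkord -sum1_card.
  by rewrite big_mkcond; apply: eq_bigr => i _; rewrite inE; case: dvdn.
have ql : (n %/ l)%:R <= n%:R / l%:R :> R.
  by rewrite ler_pdivlMr ?ltr0n// -natrM ler_nat leq_divM.
have hh : 0 <= 2 * h by rewrite mulr_ge0.
rewrite -(mulr_natr (- c) n) -(mulr_natr (2 * h) (n %/ l)).
have -> : - c * n%:R = - (2 * h * (n%:R / l%:R)) by rewrite /c; ring.
by rewrite addrC subr_le0; exact: ler_wpM2l hh _ _ ql.
Qed.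

(** By (x + y)^2 <= 2 x^2 + 2 y^2, the constant part gives at most 2 c^2 n^2 = 8 h^2 n^2 / l^2 <= 32
    h^2 n and the bump column 8 h^2 n. *)
Lemma profile_sqr_le : (n <= 4 * l ^ 2)%N ->
  ip profile profile <= 40 * h ^+ 2 * n%:R.
Proof.
move=> nl.
have mn : (m < n)%N by rewrite (leq_ltn_trans _ halfn)// -mS.
apply: (@le_trans _ _ (\sum_(i < n) \sum_(j < n)
  (2 * c ^+ 2 + (if j == m :> nat then 8 * h ^+ 2 else 0)))).
  apply: le_sum2 => i j; rewrite /profile -expr2.
  set x := (if (j < _)%N then _ else _); set y := (if _ then w _ else 0).
  have x2 : x ^+ 2 <= c ^+ 2 by rewrite /x; case: ifP => // _; rewrite expr0n sqr_ge0.
  have y2 : y ^+ 2 <= (if j == m :> nat then 4 * h ^+ 2 else 0).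
    rewrite /y; case: ifP => _; last by rewrite expr0n.
    have -> : 4 * h ^+ 2 = (2 * h) ^+ 2 by ring.
    by rewrite lerXn2r ?nnegrE ?mulr_ge0.
  have := sqr_ge0 (x - y); move: y2; case: ifP => _; rewrite !expr2; lra.
have row (i : 'I_n) : \sum_(j < n) (2 * c ^+ 2 + (if j == m :> nat then 8 * h ^+ 2 else 0))
    = 2 * c ^+ 2 * n%:R + 8 * h ^+ 2.
  rewrite big_split /= sumr_const card_ord mulr_natr; congr (_ + _).
  by rewrite -big_mkcond (big_pred1 (Ordinal mn)).
rewrite (eq_bigr _ (fun i _ => row i)) sumr_const card_ord -[leLHS]mulr_natr.
rewrite ler_pM2r ?ltr0n ?(ltn_trans _ n2)//.
have l2 : 0 < l%:R ^+ 2 :> R by rewrite exprn_gt0// ltr0n.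
have -> : c ^+ 2 = 4 * h ^+ 2 / l%:R ^+ 2.
  by rewrite /c; field; rewrite pnatr_eq0 -lt0n.
have nl' : n%:R / l%:R ^+ 2 <= 4 :> R.
  by rewrite ler_pdivrMr// -natrX -natrM ler_nat.
have := ler_wpM2l (sqr_ge0 h) nl'.
have -> : 2 * (4 * h ^+ 2 / l%:R ^+ 2) * n%:R = 8 * (h ^+ 2 * (n%:R / l%:R ^+ 2)).
  by ring.
by clear row; lra.
Qed.

End Profile.
End LowerBound.

(** * Block sums of the noise and the averaged lower bound *)

Section Blocks.
Context {R : realType}.
Implicit Types (z : nat -> R).

(** The sum S_B of the overview, as a linear form in the flattened noise so that the moment lemmas
    apply. *)
Definition block_form n l B z : R :=
  linform (fun p => ((p %/ n %/ l == B)%N && (p %% n == n./2.-1)%N)%:R) (n ^ 2) z.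

Lemma block_formE n l B z : block_form n l B z =
  \sum_(i < n) \sum_(j < n)
    ((i %/ l == B)%N && (j == n./2.-1 :> nat))%:R * (noise z : grid R n) i j.
Proof.
by rewrite (sum_noise _ (fun i j => ((i %/ l == B)%N && (j == n./2.-1 :> nat))%:R)).
Qed.

(** The remaining n mod l rows all fall in block n / l, which [B < n %/ l] excludes. *)
Lemma block_count n l B : (0 < l)%N -> (B < n %/ l)%N ->
  \sum_(i < n) ((i %/ l == B)%N)%:R = l%:R :> R.
Proof.
move=> l0 Bq.
suff aux N : N = (n %/ l * l + n %% l)%N ->
    \sum_(i < N) ((i %/ l == B)%N)%:R = l%:R :> R by exact: aux (divn_eq n l).
move=> ->; rewrite big_split_ord /= [X in _ + X]big1 => [|i _].
  rewrite addr0 -(sum_mulord (fun i => ((i %/ l == B)%N)%:R)).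
  rewrite (bigD1 (Ordinal Bq))//= [X in _ + X]big1 ?addr0 => [|k kB].
    rewrite (eq_bigr (fun=> 1)) ?sumr_const ?card_ord// => r _.
    by rewrite divnMDl// (divn_small (ltn_ord r)) addn0 eqxx.
  rewrite big1// => r _; rewrite divnMDl// (divn_small (ltn_ord r)) addn0.
  by move: kB; rewrite -val_eqE /= => /negbTE ->.
have il : (i < l)%N by rewrite (ltn_trans (ltn_ord i))// ltn_mod.
by rewrite divnMDl// (divn_small il) addn0 gtn_eqF.
Qed.

Lemma block_coef_sqr n l B : (1 < n)%N -> (0 < l)%N -> (B < n %/ l)%N ->
  \sum_(p < n ^ 2) ((p %/ n %/ l == B)%N && (p %% n == n./2.-1)%N)%:R ^+ 2 = l%:R :> R.
Proof.
move=> n2 l0 Bq.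
rewrite (sum_noise_sqr _ (fun i j => ((i %/ l == B)%N && (j == n./2.-1)%N)%:R)).
rewrite -[RHS](block_count n l B)//; apply: eq_bigr => i _.
have mn : (n./2.-1 < n)%N.
  by rewrite (leq_ltn_trans (leq_pred _))// ltn_half_lt ltnW.
rewrite (bigD1 (Ordinal mn))//= eqxx andbT -natrX big1 ?addr0 => [|j].
  by case: eqP.
by rewrite -val_eqE /= => /negbTE ->; rewrite andbF expr0n.
Qed.

Lemma sum_sum2 n q (F : 'I_q -> 'I_n -> 'I_n -> R) :
  \sum_(B < q) \sum_(i < n) \sum_(j < n) F B i j =
  \sum_(i < n) \sum_(j < n) \sum_(B < q) F B i j.
Proof.
by rewrite exchange_big; apply: eq_bigr => i _; rewrite exchange_big.
Qed.

(** The part of <v, z> without the random signs: its coefficients are deterministic, so its mean is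
    0. *)
Definition drift n l (h : R) z : R := linform (fun p =>
  (if (p %% n < n./2)%N then 2 * h / l%:R else 0) +
  (if (p %% n == n./2.-1)%N then h else 0)) (n ^ 2) z.

(** The test direction may depend on z, as [limit_risk_ge] holds for each z separately. The signs
    turn each S_B into |S_B|, and the 1 in 1 + sgn keeps the bumps within [0, 2 h]. *)
Lemma limit_risk_ge_blocks n l (h : R) z : (1 < n)%N -> (0 < l)%N ->
  (n <= 4 * l ^ 2)%N -> 0 <= h ->
  2 * (drift n l h z + h * \sum_(B < n %/ l) `|block_form n l B z|) -
    40 * h ^+ 2 * n%:R <= limit_risk (n := n) z.
Proof.
move=> n2 l0 nl h0.
(* The sign is 0 on the incomplete last block, where the bump is then h and only feeds [drift]. *)
pose sgB B := if (B < n %/ l)%N then Num.sg (block_form n l B z) else 0.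
have sg1 B : -1 <= sgB B <= 1.
  by rewrite /sgB; case: ifP => _; [case: sgrP => _|]; apply/andP; split; lra.
pose w B := h * (1 + sgB B).
have w0 B : 0 <= w B.
  by rewrite mulr_ge0//; have /andP[] := sg1 B; lra.
have wh B : w B <= 2 * h.
  by rewrite /w mulrC ler_wpM2r//; have /andP[] := sg1 B; lra.
have := limit_risk_ge _ z (profile_tangent n2 l l0 h h0 w w0 wh).
apply: le_trans; apply: lerB; last exact: profile_sqr_le.
rewrite ler_pM2l// le_eqVlt; apply/orP; left; apply/eqP.
transitivity (\sum_(i < n) \sum_(j < n)
    (((if (j < n./2)%N then 2 * h / l%:R else 0) +
      (if (j == n./2.-1 :> nat) then h else 0)) * (noise z : grid R n) i j
     + h * \sum_(B < n %/ l) (sgB B *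
        (((i %/ l == B)%N && (j == n./2.-1 :> nat))%:R * (noise z : grid R n) i j)))).
  rewrite sum2D sum2Z -sum_sum2 /drift; congr (_ + h * _).
    by rewrite (sum_noise _ (fun _ j => (if (j < n./2)%N then 2 * h / l%:R else 0) +
      (if (j == n./2.-1 :> nat) then h else 0))).
  apply: eq_bigr => B _; rewrite sum2Z -block_formE normrEsg.
  by rewrite /sgB ltn_ord.
apply: eq_sum2 => i j; rewrite /profile /w.
have -> : \sum_(B < n %/ l) (sgB B *
        (((i %/ l == B)%N && (j == n./2.-1 :> nat))%:R * (noise z : grid R n) i j)) =
    sgB (i %/ l)%N * (j == n./2.-1 :> nat)%:R * (noise z : grid R n) i j.
  have [iq|iq] := ltnP (i %/ l) (n %/ l).
    rewrite (bigD1 (Ordinal iq))//= eqxx /= mulrA big1 ?addr0// => B.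
    by rewrite -val_eqE /= eq_sym => /negbTE ->; rewrite mul0r mulr0.
  rewrite {2}/sgB ltnNge iq !mul0r big1// => B _.
  by rewrite gtn_eqF ?mul0r ?mulr0// (leq_trans (ltn_ord B)).
set x := noise z i j; set d := (if (j < n./2)%N then _ else _).
by case: (j == _ :> nat); rewrite /=; ring.
Qed.

Lemma gmean_limit_risk_ge n l (h tau : R) : (1 < n)%N -> (0 < l)%N ->
  (n <= 4 * l ^ 2)%N -> 0 <= h -> 0 <= tau ->
  2 * h * (n %/ l)%:R * (tau * (mom2 * l%:R) - tau ^+ 3 * (3 * mom4ub * l%:R ^+ 2))
    - 40 * h ^+ 2 * n%:R <= gmean (n ^ 2) (limit_risk (n := n)).
Proof.
move=> n2 l0 nl h0 tau0.
pose q B z : R := tau * block_form n l B z ^+ 2 +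
  (- tau ^+ 3) * block_form n l B z ^+ 4.
have tB B p : (p <= 4)%N -> tame (fun z => block_form n l B z ^+ p).
  move=> p4; have := tame_linform_exp (fun p => ((p %/ n %/ l == B)%N &&
    (p %% n == n./2.-1)%N)%:R : R) (n ^ 2) 0 p p4.
  by under eq_fun do rewrite add0r.
have tq B : tame (q B) by apply: tameD; apply: tameZ; exact: tB.
have td : tame (drift n l h).
  have := tame_linform_exp (fun p => (if (p %% n < n./2)%N then 2 * h / l%:R else 0) +
    (if (p %% n == n./2.-1)%N then h else 0)) (n ^ 2) 0 1 isT.
  by under eq_fun do rewrite add0r expr1.
set X := tau * (mom2 * l%:R) - _.
have gq B : (B < n %/ l)%N -> X <= gmean (n ^ 2) (q B).
  move=> Bq; rewrite /X gmeanD; [|by apply: tameZ; exact: tB..].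
  rewrite !gmeanZ; [|exact: tB..].
  have := gmean_linform_sqr (fun p => ((p %/ n %/ l == B)%N &&
    (p %% n == n./2.-1)%N)%:R : R) (n ^ 2) 0.
  under eq_fun do rewrite add0r; rewrite block_coef_sqr// expr0n add0r => ->.
  rewrite mulNr lerD2l lerN2 ler_wpM2l ?exprn_ge0//.
  have := gmean_linform_exp4 (fun p => ((p %/ n %/ l == B)%N &&
    (p %% n == n./2.-1)%N)%:R : R) (n ^ 2) 0.
  under eq_fun do rewrite add0r; rewrite block_coef_sqr//.
  by rewrite !expr0n /= mulr0 mul0r !add0r.
have gd : gmean (n ^ 2) (drift n l h) = 0.
  have := gmean_linform (fun p => (if (p %% n < n./2)%N then 2 * h / l%:R else 0) +
    (if (p %% n == n./2.-1)%N then h else 0)) (n ^ 2) 0.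
  by under eq_fun do rewrite add0r.
pose f z : R := 2 * (drift n l h z + h * \sum_(B < n %/ l) q B z) +
  - (40 * h ^+ 2 * n%:R).
have ts : tame (fun z => \sum_(B < n %/ l) q B z) by apply: tame_sum.
have tds : tame (fun z => drift n l h z + h * \sum_(B < n %/ l) q B z).
  by apply: tameD => //; exact: tameZ.
have tf : tame f by apply: tameD; [exact: tameZ|exact: tame_cst].
apply: (@le_trans _ _ (gmean (n ^ 2) f)); last first.
  apply: le_gmean => //; first exact: tame_limit_risk.
  move=> z; apply: le_trans (limit_risk_ge_blocks n l h z n2 l0 nl h0).
  rewrite lerD2r ler_pM2l// lerD2l ler_wpM2l//; apply: ler_sum => B _.
  by rewrite /q mulNr; exact: norm_ge_poly.
rewrite /f gmeanD; [|exact: tameZ|exact: tame_cst].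
rewrite gmean_cst lerD2r gmeanZ// gmeanD//; last exact: tameZ.
rewrite gd add0r gmeanZ// gmean_sum// -!mulrA ler_pM2l// ler_wpM2l//.
have -> : (n %/ l)%:R * X = \sum_(B < n %/ l) X.
  by rewrite sumr_const card_ord mulr_natl.
by apply: ler_sum => B _; exact: gq (ltn_ord B).
Qed.

End Blocks.

(** * Choice of block length and amplitudes *)

Section Conclusion.
Context {R : realType}.

(** n <= 4 l^2 controls the norm of the test direction; l^2 <= n bounds n / l below by sqrt n. *)
Lemma sqrt_bracket n : (0 < n)%N ->
  exists l, [/\ (0 < l)%N, (l ^ 2 <= n)%N & (n <= 4 * l ^ 2)%N].
Proof.
elim: n => // -[_ _|n /(_ isT) [l [l0 ln nl]] _]; first by exists 1%N.
have [h|h] := leqP (l.+1 ^ 2) n.+2.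
  by exists l.+1; split=> //; move: nl; rewrite -!mulnn; lia.
exists l; split=> //; first exact: leqW.
by move: h; rewrite -!mulnn; nia.
Qed.

(* Optimised over [tau] (so that [tau ^+ 2 * l] is constant), then over [h]. *)
Lemma gmean_limit_risk_blocks n l : (1 < n)%N -> (0 < l)%N -> (l ^ 2 <= n)%N ->
  (n <= 4 * l ^ 2)%N ->
  mom2 ^+ 3 / (3840 * mom4ub) * (n%:R / l%:R) <=
    gmean (n ^ 2) (limit_risk (R := R) (n := n)).
Proof.
move=> n2 l0 ln nl.
have m2 := @mom2_gt0 R; have M0 := @mom4ub_gt0 R.
have lR : 0 < l%:R :> R by rewrite ltr0n.
(* Makes the quartic term exactly half of the quadratic one. *)
pose tau : R := Num.sqrt (mom2 / (6 * mom4ub * l%:R)).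
have tau2 : tau ^+ 2 = mom2 / (6 * mom4ub * l%:R).
  by rewrite sqr_sqrtr// divr_ge0 ?(ltW m2)// !mulr_ge0// ltW.
have tau0 : 0 <= tau by rewrite sqrtr_ge0.
(* The maximiser of h tau [mom2] n / 2 - 40 h^2 n, the bound left once n <= 2 l floor(n / l) is
   used; the cost is then half of the gain. *)
pose h : R := tau * mom2 / 160.
have h0 : 0 <= h by rewrite /h !mulr_ge0// ltW.
apply: le_trans (gmean_limit_risk_ge n l h tau n2 l0 nl h0 tau0).
have -> : tau * (mom2 * l%:R) - tau ^+ 3 * (3 * mom4ub * l%:R ^+ 2) =
    tau * (mom2 * l%:R) / 2.
  rewrite exprS tau2; field; by rewrite !gt_eqF.
(* With q = floor(n / l) >= 1, n < (q + 1) l <= 2 q l. *)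
have ql : n%:R <= 2 * ((n %/ l)%:R * l%:R) :> R.
  rewrite -!natrM ler_nat; have := ltn_ceil n l0.
  have : (0 < n %/ l)%N by rewrite divn_gt0// (leq_trans _ ln)// -mulnn leq_pmull.
  by nia.
set Q : R := (n %/ l)%:R in ql *.
have hm : 0 <= h * tau * mom2 by rewrite !mulr_ge0// ltW.
have e1 : h * tau * mom2 * n%:R <= h * tau * mom2 * (2 * (Q * l%:R)) by rewrite ler_wpM2l.
have e2 : h * tau * mom2 / 4 * n%:R = mom2 ^+ 3 / (3840 * mom4ub) * (n%:R / l%:R).
  have -> : h * tau * mom2 / 4 * n%:R = tau ^+ 2 * mom2 ^+ 2 / 640 * n%:R.
    by rewrite /h; field.
  by rewrite tau2; field; rewrite !gt_eqF.
rewrite -e2; have e3 : 40 * h ^+ 2 = h * tau * mom2 / 4 by rewrite /h; field.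
rewrite e3; lra.
Qed.

(** The one-point grid has no edges, so every direction is tangent and v = z gives the lower bound
    z^2. The profile needs two columns, hence this separate case. *)
Lemma limit_risk_one : mom2 <= gmean 1 (limit_risk (R := R) (n := 1)).
Proof.
have T1 (v : grid R 1) : tangent v.
  rewrite /tangent /= /TV_dir /edge_sum big1// => u _; rewrite big_pred0// => v'.
  by rewrite /grid_edge !ord1 /=.
have := gmean_linform_sqr (fun=> 1 : R) 1 0.
rewrite big_ord_recl big_ord0 expr1n addr0 mulr1 expr0n add0r => <-.
apply: le_gmean; [exact: tame_linform_exp|exact: tame_limit_risk|] => z.
apply: le_trans (limit_risk_ge (noise z : grid R 1) z (T1 _)).
by rewrite /linform /ip !big_ord_recl !big_ord0 /noise /=; lra.
Qed.

Lemma powR_three_quarters n l : (0 < n)%N -> (l ^ 2 <= n)%N ->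
  l%:R * n%:R <= (n ^ 2)%:R `^ (3 / 4) :> R.
Proof.
move=> n0 ln.
have nR : 0 < n%:R :> R by rewrite ltr0n.
have -> : (n ^ 2)%:R `^ (3 / 4) = n%:R * Num.sqrt n%:R :> R.
  rewrite natrX -powR_mulrn ?ltW// -powRrM.
  have -> : 2%:R * (3 / 4) = 1 + 2^-1 :> R by field.
  by rewrite powRD ?gt_eqF ?implybT// powRr1 ?ltW// powR12_sqrt ?ltW.
rewrite mulrC ler_pM2l// -[leLHS]ger0_norm// -sqrtr_sqr ler_wsqrtr//.
by rewrite -natrX ler_nat.
Qed.
End Conclusion.

Theorem theorem2p3 (R : realType) :
  exists c : R, 0 < c /\
  forall n : nat, (0 < n)%N ->
    exists L : R,
      ((sigma ^-2)%:E * MSE_tvd (TV_norm (theta_star R n)) sigma (theta_star R n))%E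
        @[sigma --> 0^'+] --> L%:E
      /\ c / ((n ^ 2)%:R `^ (3 / 4)) <= L.
Proof.
pose kappa : R := mom2 ^+ 3 / (3840 * mom4ub).
have m2 := @mom2_gt0 R; have M0 := @mom4ub_gt0 R.
have k0 : 0 < kappa.
  rewrite /kappa; apply: divr_gt0; first exact: exprn_gt0.
  by apply: mulr_gt0 M0; rewrite ltr0n.
(* [mom2] serves n = 1 and [kappa] all larger n. *)
exists (Num.min mom2 kappa); split; first by rewrite lt_min m2.
move=> n n0; exists (gmean (n ^ 2) (limit_risk (R := R) (n := n)) * (n ^ 2)%:R^-1).
split; first exact: risk_limit.
have [n1|n2] := leqP n 1.
  have -> : n = 1%N by apply/eqP; rewrite eqn_leq n1.
  rewrite exp1n powR1 invr1 !mulr1 ge_min; apply/orP; left.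
  exact: limit_risk_one.
have [l [l0 ln nl]] := sqrt_bracket n n0.
have lR : 0 < l%:R :> R by rewrite ltr0n.
have nR : 0 < n%:R :> R by rewrite ltr0n.
have P := @powR_three_quarters R n l n0 ln.
(* l n <= N^(3/4) since l <= sqrt n, and kappa / (l n) is the block bound kappa n / l divided by
   N. *)
apply: (@le_trans _ _ (kappa / (l%:R * n%:R))).
  apply: ler_pM; rewrite ?invr_ge0 ?powR_ge0 ?le_min ?(ltW m2) ?(ltW k0)//.
    by rewrite ge_min lexx orbT.
  by rewrite lef_pV2 ?posrE ?mulr_gt0// (lt_le_trans _ P)// mulr_gt0.
have -> : kappa / (l%:R * n%:R) = kappa * (n%:R / l%:R) * (n ^ 2)%:R^-1.
  by rewrite natrX; field; rewrite !gt_eqF.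
by apply: ler_wpM2r; [rewrite invr_ge0|exact: gmean_limit_risk_blocks].
Qed.
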